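(* On $\mathbb C^3\otimes\mathbb C^3$ let $V$ be the swap operator, $P_-=(I-V)/2$ the projector onto the antisymmetric subspace, $\rho_W=\tfrac12\,\tfrac{P_-}{3}+\tfrac12\,\tfrac{I_9}{9}$, and $$\rho_{AB}=\tfrac12|00\rangle\langle00|+\tfrac12\,\rho_W .$$ Let $|v_j\rangle=\cos\theta|0\rangle+\sin\theta\cos\tfrac{4\pi j}{5}|1\rangle+\sin\theta\sin\tfrac{4\pi j}{5}|2\rangle$ with $\cos\theta,\sin\theta>0$, $\cos^2\theta=\tfrac1{\sqrt5}$, and let $B_j=I-2|v_j\rangle\langle v_j|$, $j\in\mathbb Z/5$, $D=\sum_{j\in\mathbb Z/5}B_jB_{j+1}$. Then: (i) $\rho_{AB}$ is entangled; indeed its partial transpose has the eigenvalue $\tfrac{37-3\sqrt{177}}{144}<0$; (ii) $\rho_{AB}$ is local for all local projective measurements; consequently, in every bipartite scenario whose local contexts consist of commuting projective measurements, the empirical model of $\rho_{AB}$ admits a GLHV decomposition; (iii) $\rho_A=\rho_B=\tfrac23|0\rangle\langle0|+\tfrac16|1\rangle\langle1|+\tfrac16|2\rangle\langle2|$, $\operatorname{Tr}(\rho_BD)=\tfrac53-2\sqrt5>-3$, and the local statistics of this marginal for the five contexts $\{B_j,B_{j+1}\}$ are noncontextual; (iv) if Alice measures $\{|0\rangle\langle0|,I-|0\rangle\langle0|\}$ and obtains the outcome $|0\rangle\langle 0|$, which has probability $\tfrac23$, Bob's conditional state is $\rho_{B|0}=\tfrac{19}{24}|0\rangle\langle0|+\tfrac5{48}|1\rangle\langle1|+\tfrac5{48}|2\rangle\langle2|$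 and $\operatorname{Tr}(\rho_{B|0}D)=\tfrac{35-33\sqrt5}{12}<-3$; (v) the empirical model of $\rho_{AB}$ in the scenario where Alice has the single measurement $\{|0\rangle\langle0|,I-|0\rangle\langle0|\}$ and Bob has the five contexts $\{B_j,B_{j+1}\}$, $j\in\mathbb Z/5$, admits no GNCHV model.
   Context: Since $\langle v_j|v_{j+1}\rangle=0$ (indices mod 5), $B_j$ and $B_{j+1}$ commute and are jointly measurable; their outcomes are $\pm1$. Local for all local projective measurements: there are a probability space $(\Lambda,q)$ and, for every projective measurement $M=\{M_a\}$ of Alice and $N=\{N_b\}$ of Bob, response distributions $p_A(a|M,\lambda)$, $p_B(b|N,\lambda)$ such that $\operatorname{Tr}(\rho_{AB}\,M_a\otimes N_b)=\int p_A(a|M,\lambda)p_B(b|N,\lambda)\,dq(\lambda)$ for all $M,N,a,b$. Scenarios. Each party $i$ ($i=A,B$) has a set of measurements and a family $\mathcal C_i$ of local contexts, a local context $C_i$ being a set of compatible (commuting) measurements; a multipartite context is $C=(C_A,C_B)$ and the tested family is $\mathcal C\subseteq\mathcal C_A\times\mathcal C_B$. The empirical model assigns to each $C\in\mathcal C$ the Born-rule joint outcome distribution $p_C$. Write $m_{ij}$ for the outcome of measurement $j\in C_i$. Sums over a hidden variable are read as integrals if the hidden variable is continuous. Noncontextual local statistics of party $i$: there are a hidden variable $\lambda_i$ with a single distribution $q_i$ and context-independent response distributions $p_i(\cdot|j,\lambda_i)$, one per measurement $j$, such that $p_{C_i}(\{m_{ij}\}_{j\in C_i})=\sum_{\lambda_i}q_i(\lambda_i)\prod_{j\in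 C_i}p_i(m_{ij}|j,\lambda_i)$ for all $C_i\in\mathcal C_i$, where $p_{C_i}$ is the distribution from the reduced state. GLHV: there are one hidden variable $\lambda$, one distribution $q(\lambda)$ common to all tested contexts, and block response distributions $p_i(\cdot|C_i,\lambda)$ (arbitrary joint distributions of the outcomes in $C_i$) such that $p_C=\sum_\lambda q(\lambda)\prod_i p_i(\{m_{ij}\}_{j\in C_i}|C_i,\lambda)$ for every $C\in\mathcal C$. GNCHV: there are one hidden variable $\xi$, one distribution $q(\xi)$ and context-independent response distributions $p(\cdot|j,\xi)$, one per measurement $j$ of either party, such that $p_C=\sum_\xi q(\xi)\prod_i\prod_{j\in C_i}p(m_{ij}|j,\xi)$ for every $C\in\mathcal C$. Every noncontextual model for the five contexts $\{B_j,B_{j+1}\}$ satisfies $\langle D\rangle\ge-3$ (the KCBS bound). *)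

(* Defs.v *)
From HB Require Import structures.
From mathcomp Require Export all_boot all_order all_algebra finmap.
From mathcomp Require Export mathcomp_extra boolp classical_sets functions.
From mathcomp Require Export reals trigo measure lebesgue_measure.
From mathcomp Require Export lebesgue_integral probability.
From mathcomp Require Export spectral.
From mathcomp.real_closed Require Export complex mxtens.

Set Implicit Arguments.
Unset Strict Implicit.
Unset Printing Implicit Defensive.

Import Order.TTheory GRing.Theory Num.Theory.
Local Open Scope classical_set_scope.
Local Open Scope ring_scope.
Local Open Scope complex_scope.
Local Open Scope sesquilinear_scope.

(* R is a realType, the scalars are R[i], and
   the tensor product of matrices is *t. The basis vector |i>|j> of a tensor
   product has index mxtens_index (i, j), and |i><j| is delta_mx i j. *)

Section Quantum.
Variable R : realType.
Local Notation C := R[i].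

Definition psd d (A : 'M[C]_d) : Prop :=
  forall u : 'cV[C]_d, 0 <= (u^t* *m A *m u) 0 0.

Definition density d (rho : 'M[C]_d) : Prop :=
  [/\ rho \is hermsymmx, psd rho & \tr rho = 1].

Definition separable dA dB (rho : 'M[C]_(dA * dB)) : Prop :=
  exists (n : nat) (w : 'I_n -> R)
         (s : 'I_n -> 'M[C]_dA) (t : 'I_n -> 'M[C]_dB),
    [/\ forall k, 0 <= w k,
        \sum_k w k = 1,
        forall k, density (s k) /\ density (t k) &
        rho = \sum_k (w k)%:C *: (s k *t t k)].

Definition entangled dA dB (rho : 'M[C]_(dA * dB)) : Prop :=
  density rho /\ ~ separable rho.

(* Transposition of the second factor. *)
Definition ptranspose dA dB (rho : 'M[C]_(dA * dB)) : 'M[C]_(dA * dB) :=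
  \matrix_(x, y)
    rho (mxtens_index ((mxtens_unindex x).1, (mxtens_unindex y).2))
        (mxtens_index ((mxtens_unindex y).1, (mxtens_unindex x).2)).

(* Reduced states of the first and second party. *)
Definition redA dA dB (rho : 'M[C]_(dA * dB)) : 'M[C]_dA :=
  \matrix_(i, i') \sum_k rho (mxtens_index (i, k)) (mxtens_index (i', k)).

Definition redB dA dB (rho : 'M[C]_(dA * dB)) : 'M[C]_dB :=
  \matrix_(j, j') \sum_k rho (mxtens_index (k, j)) (mxtens_index (k, j')).

(* Probability of Alice's outcome with projector P, and Bob's state given it. *)
Definition probA dA dB (rho : 'M[C]_(dA * dB)) (P : 'M[C]_dA) : C :=
  \tr (rho *m (P *t (1%:M : 'M[C]_dB))).

Definition condB dA dB (rho : 'M[C]_(dA * dB)) (P : 'M[C]_dA) : 'M[C]_dB :=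
  (probA rho P)^-1 *:
    redB ((P *t (1%:M : 'M[C]_dB)) *m rho *m (P *t (1%:M : 'M[C]_dB))).

Definition projective d (O : finType) (M : O -> 'M[C]_d) : Prop :=
  [/\ forall a, M a \is hermsymmx,
      forall a b, M a *m M b = if a == b then M a else 0 &
      \sum_a M a = 1%:M].

(* A response distribution: for every value of the hidden variable, a
   probability distribution on the outcomes, depending measurably on it. *)
Definition response disp (L : measurableType disp) (O : finType)
    (p : O -> L -> R) : Prop :=
  [/\ forall o, measurable_fun [set: L] (p o),
      forall o l, 0 <= p o l &
      forall l, \sum_o p o l = 1].

Definition local_projective dA dB (rho : 'M[C]_(dA * dB)) : Prop :=
  exists (disp : measure_display) (L : measurableType disp)
         (q : probability L R)
         (pA : forall O : finType, (O -> 'M[C]_dA) -> O -> L -> R)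
         (pB : forall O : finType, (O -> 'M[C]_dB) -> O -> L -> R),
    [/\ forall (O : finType) (M : O -> 'M[C]_dA),
          projective M -> response (pA O M),
        forall (O : finType) (N : O -> 'M[C]_dB),
          projective N -> response (pB O N) &
        forall (OA OB : finType) (M : OA -> 'M[C]_dA) (N : OB -> 'M[C]_dB),
          projective M -> projective N -> forall (a : OA) (b : OB),
          \tr (rho *m (M a *t N b)) =
          (Rintegral q [set: L] (fun l => pA OA M a l * pB OB N b l))%:C].

End Quantum.

Record party := Party {
  meas : choiceType;
  outcome : meas -> finType;
  contexts : set {fset meas} }.
Arguments contexts : clear implicits.

(* Joint outcomes of the measurements in K. *)
Definition joint (X : party) (K : {fset meas X}) : finType :=
  {dffun forall j : K, outcome (val j)}.

Record scenario := Scenario {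
  alice : party;
  bob : party;
  tested : set ({fset meas alice} * {fset meas bob})%type;
  tested_sub : tested `<=` contexts alice `*` contexts bob }.
Arguments tested : clear implicits.

Section Models.
Variable R : realType.
Local Notation C := R[i].

(* The values are complex because the Born rule is a trace over C; only the
   values on (tested) contexts matter. *)
Definition local_model (X : party) : Type :=
  forall K : {fset meas X}, joint K -> C.

Definition empirical_model (S : scenario) : Type :=
  forall (KA : {fset meas (alice S)}) (KB : {fset meas (bob S)}),
    joint KA -> joint KB -> C.

Definition noncontextual (X : party) (e : local_model X) : Prop :=
  exists (disp : measure_display) (L : measurableType disp)
         (q : probability L R)
         (p : forall j : meas X, outcome j -> L -> R),
    (forall j, response (p j)) /\
    forall K, contexts X K -> forall m : joint K,
      e K m = (Rintegral q [set: L]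
                 (fun l => \prod_(j : K) p (val j) (m j) l))%:C.

Definition GLHV (S : scenario) (e : empirical_model S) : Prop :=
  exists (disp : measure_display) (L : measurableType disp)
         (q : probability L R)
         (pA : forall K : {fset meas (alice S)}, joint K -> L -> R)
         (pB : forall K : {fset meas (bob S)}, joint K -> L -> R),
    [/\ forall K, contexts (alice S) K -> response (pA K),
        forall K, contexts (bob S) K -> response (pB K) &
        forall KA KB, tested S (KA, KB) ->
        forall (mA : joint KA) (mB : joint KB),
          e KA KB mA mB =
          (Rintegral q [set: L] (fun l => pA KA mA l * pB KB mB l))%:C].

Definition GNCHV (S : scenario) (e : empirical_model S) : Prop :=
  exists (disp : measure_display) (L : measurableType disp)
         (q : probability L R)
         (pA : forall j : meas (alice S), outcome j -> L -> R)
         (pB : forall j : meas (bob S), outcome j -> L -> R),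
    [/\ forall j, response (pA j),
        forall j, response (pB j) &
        forall KA KB, tested S (KA, KB) ->
        forall (mA : joint KA) (mB : joint KB),
          e KA KB mA mB =
          (Rintegral q [set: L] (fun l =>
             (\prod_(j : KA) pA (val j) (mA j) l) *
             (\prod_(j : KB) pB (val j) (mB j) l)))%:C].

Definition assignment (d : nat) (X : party) : Type :=
  forall j : meas X, outcome j -> 'M[C]_d.

Definition compatible_projective d (X : party) (M : assignment d X) : Prop :=
  forall K, contexts X K ->
    (forall j, j \in K -> projective (M j)) /\
    (forall j k, j \in K -> k \in K -> forall a b, comm_mx (M j a) (M k b)).

(* The factors commute when K is a context, so their order is immaterial. *)
Definition joint_proj d (X : party) (M : assignment d X)
    (K : {fset meas X}) (m : joint K) : 'M[C]_d :=
  \big[mulmx/1%:M]_(j : K) M (val j) (m j).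

Definition born_local d (X : party) (M : assignment d X) (rho : 'M[C]_d) :
    local_model X :=
  fun K m => \tr (rho *m joint_proj M m).

Definition born dA dB (S : scenario) (M : assignment dA (alice S))
    (N : assignment dB (bob S)) (rho : 'M[C]_(dA * dB)) : empirical_model S :=
  fun KA KB mA mB => \tr (rho *m (joint_proj M mA *t joint_proj N mB)).

End Models.

Section Example.
Variable R : realType.
Local Notation C := R[i].

(* V = \sum_(i, j) |i><j| (x) |j><i| *)
Definition swap_op d : 'M[C]_(d * d) :=
  \sum_(i < d) \sum_(j < d) delta_mx i j *t delta_mx j i.

Definition P_anti : 'M[C]_(3 * 3) := 2^-1 *: (1%:M - swap_op 3).

Definition rho_W : 'M[C]_(3 * 3) :=
  2^-1 *: (3^-1 *: P_anti) + 2^-1 *: (9^-1 *: 1%:M).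

Definition proj0 : 'M[C]_3 := delta_mx 0 0.

Definition rho_AB : 'M[C]_(3 * 3) :=
  2^-1 *: (proj0 *t proj0) + 2^-1 *: rho_W.

Definition kcbs_vec (theta : R) (j : 'Z_5) : 'cV[C]_3 :=
  let phi : R := 4 * pi * (j : nat)%:R / 5 in
  (cos theta)%:C *: delta_mx 0 0
  + (sin theta * cos phi)%:C *: delta_mx 1 0
  + (sin theta * sin phi)%:C *: delta_mx 2 0.

Definition kcbs_obs (theta : R) (j : 'Z_5) : 'M[C]_3 :=
  1%:M - 2 *: (kcbs_vec theta j *m (kcbs_vec theta j)^t*).

Definition kcbs_op (theta : R) : 'M[C]_3 :=
  \sum_(j : 'Z_5) kcbs_obs theta j *m kcbs_obs theta (j + 1).

(* Contexts {B_j, B_(j+1)}; the boolean b stands for the outcome (-1) ^+ b. *)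
Definition kcbs_party : party :=
  @Party 'Z_5 (fun=> bool) (range (fun j : 'Z_5 => [fset j; (j + 1)%R]%fset)).

(* Spectral projector of B_j for the eigenvalue (-1) ^+ b. *)
Definition kcbs_proj (theta : R) : assignment R 3 kcbs_party :=
  fun (j : 'Z_5) (b : bool) =>
    2^-1 *: (1%:M + (-1) ^+ b *: kcbs_obs theta j).

Definition single_party : party :=
  @Party unit (fun=> bool) [set [fset tt]%fset].

(* The measurement {|0><0|, I - |0><0|}, with |0><0| labelled by true. *)
Definition zero_proj : assignment R 3 single_party :=
  fun (_ : unit) (b : bool) => if b then proj0 else 1%:M - proj0.

End Example.

Definition kcbs_scenario : scenario :=
  @Scenario single_party kcbs_party
    (contexts single_party `*` contexts kcbs_party) (fun _ h => h).

(* Main.v *)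
From HB Require Import structures.
From mathcomp Require Import ring lra zify.
From mathcomp Require Import interval_inference constructive_ereal measurable_realfun.
Require Import Defs.
Import Order.TTheory GRing.Theory Num.Theory.

(** The locality of [rho_AB] rests on Werner's model for antisymmetric Werner
    states, made finite. The hidden variable is a vector [psi] of [C^3]; Bob
    answers [b] with probability [<psi|N_b|psi> / <psi|psi>], and Alice, for an
    orthonormal basis [e_i], answers [i] with a probability that is a polynomial
    of degree 5 in the numbers [|<e_i|psi>|^2 / <psi|psi>]. The correlations
    then only involve moments of [psi] of bidegree (6, 6), so the Gaussian
    vector may be replaced by a finite one with the same moments: independent
    coordinates [r * zeta ^+ m], with [zeta] a primitive 7th root of unity and
    [r] drawn from a quadrature rule. Unitary invariance of these moments comes
    from the identity E [(s.psi)^n (r.conj psi)^n] = n! (s.r)^n.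

    Entanglement is the PPT criterion; the KCBS marginal is reproduced by random
    independent pairs of vertices of the pentagon; and a GNCHV model, restricted
    to Alice's outcome |0><0|, would satisfy the KCBS inequality. *)

Set Implicit Arguments.
Unset Strict Implicit.
Unset Printing Implicit Defensive.
Local Open Scope ring_scope.

(** * Gaussian moments *)

Section GaussianMoments.
Variable C : numClosedFieldType.

(** Since [rho_AB] equals [1/2 |00><00| + 5/72 I - 1/24 V], the Werner half requires that, in any
    common orthonormal basis, the two answers agree with probability 1/6: given Alice's answer, her
    index and each other index must have weights 2 : 5 for Bob. Answering with the least frequent of
    n indices drawn with law proportional to [|<e_i|psi>|^2] is a polynomial substitute for Werner's
    rule, which picks the index of least modulus. For n = 4 it yields agreement with probability
    6/35 > 1/6, for n = 5 with probability 9/56 < 1/6; so five draws leave some slack, and the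
    random answer after draws of type (2, 2, 1) uses it up exactly.

    The responses are rational functions of the vector, with denominators [nsq ^+ 5] for Alice and
    [nsq] for Bob. Weighting each vector by [nsq ^+ 6] clears both, and only polynomial moments
    remain. Bob's quadratic form raises the bidegree from 5 to 6, hence seven phases and seven
    radii. The resulting finite set of vectors is not invariant under unitaries; only its moments up
    to that degree are, and nothing else is used. *)

Definition gauss_moments (n : nat) (I : finType) (w X X' : I -> C) (k : C) :=
  forall a b, (a <= n)%N -> (b <= n)%N ->
    \sum_x w x * (X x ^+ a * X' x ^+ b) = (a == b)%:R * (a`!%:R * k ^+ a).

(** [X'] stands for the conjugate of [X] but is kept as an unrelated function, so that the two can
    be scaled by independent factors. This independence later turns one power identity into all
    mixed moments. *)
Lemma gauss_scale n (I : finType) (w X X' : I -> C) k u v :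
  gauss_moments n w X X' k ->
  gauss_moments n w (fun x => u * X x) (fun x => v * X' x) (u * v * k).
Proof.
move=> H a b an bn.
transitivity (u ^+ a * v ^+ b * \sum_x w x * (X x ^+ a * X' x ^+ b)).
  by rewrite mulr_sumr; apply: eq_bigr => x _; rewrite !exprMn; ring.
rewrite H //; case: eqP => [->|_]; last by rewrite !mul0r mulr0.
by rewrite !exprMn; ring.
Qed.

(** Only the diagonal terms of the two binomial expansions survive, and ['C(a, i) ^ 2 * i! * (a -
    i)! = a! * 'C(a, i)] reassembles them into [a! * (k + l) ^ a]. *)
Lemma gauss_add n (I J : finType) (w X X' : I -> C) k (v Y Y' : J -> C) l :
  gauss_moments n w X X' k -> gauss_moments n v Y Y' l ->
  gauss_moments n (fun p : I * J => w p.1 * v p.2)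
    (fun p => X p.1 + Y p.2) (fun p => X' p.1 + Y' p.2) (k + l).
Proof.
move=> HX HY a b an bn.
rewrite -(pair_bigA _ (fun x y => w x * v y *
  ((X x + Y y) ^+ a * (X' x + Y' y) ^+ b))) /=.
have E x y : w x * v y * ((X x + Y y) ^+ a * (X' x + Y' y) ^+ b) =
   \sum_(i < a.+1) \sum_(j < b.+1) ('C(a, i)%:R * 'C(b, j)%:R) *
     ((w x * (X x ^+ (a - i) * X' x ^+ (b - j))) *
     (v y * (Y y ^+ i * Y' y ^+ j))).
  rewrite !exprDn big_distrlr /= mulr_sumr; apply: eq_bigr => i _.
  rewrite mulr_sumr; apply: eq_bigr => j _.
  by rewrite -!(mulr_natr (_ * _)); ring.
under eq_bigr => x _ do under eq_bigr => y _ do rewrite E.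
under eq_bigr => x _ do rewrite exchange_big /=.
rewrite exchange_big /=.
under eq_bigr => i _ do under eq_bigr => x _ do rewrite exchange_big /=.
under eq_bigr => i _ do rewrite exchange_big /=.
have F (i : 'I_a.+1) (j : 'I_b.+1) :
   \sum_x \sum_y ('C(a, i)%:R * 'C(b, j)%:R) *
     ((w x * (X x ^+ (a - i) * X' x ^+ (b - j))) *
     (v y * (Y y ^+ i * Y' y ^+ j)))
   = 'C(a, i)%:R * 'C(b, j)%:R *
     (((a - i == b - j)%N%:R * ((a - i)`!%:R * k ^+ (a - i)))
     * ((i == j :> nat)%:R * (i`!%:R * l ^+ i))).
  have ian : (i <= n)%N by rewrite (leq_trans _ an) // -ltnS.
  have jbn : (j <= n)%N by rewrite (leq_trans _ bn) // -ltnS.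
  rewrite -(HX _ _ (leq_trans (leq_subr _ _) an) (leq_trans (leq_subr _ _) bn)).
  rewrite -(HY _ _ ian jbn).
  rewrite big_distrlr mulr_sumr; apply: eq_bigr => x _.
  by rewrite mulr_sumr.
under eq_bigr => i _ do under eq_bigr => j _ do rewrite F.
have [ab|nab] := eqVneq a b; last first.
  rewrite mul0r; apply: big1 => i _; apply: big1 => j _.
  case: (eqVneq (i : nat) j) => [ij|]; last by rewrite mul0r !mulr0.
  case: (eqVneq (a - i)%N (b - j)%N) => [e|]; last by rewrite !mul0r mulr0.
  exfalso; move/negP: nab; apply; apply/eqP.
  by have := ltn_ord i; have := ltn_ord j; lia.
subst b; rewrite mul1r exprDn mulr_sumr; apply: eq_bigr => i _.
rewrite (bigD1 i) //= big1 ?addr0; last first.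
  move=> j ji; rewrite eq_sym in ji.
  case: (eqVneq (i : nat) j) => [/val_inj e|]; last by rewrite mul0r !mulr0.
  by rewrite e eqxx in ji.
rewrite !eqxx !mul1r -(mulr_natr (_ * _)) -(bin_fact (ltn_ord i : i <= a)%N) !natrM.
ring.
Qed.

Lemma eq_poly_coef n (f g : 'I_n -> C) :
  (forall s, \sum_i f i * s ^+ i = \sum_i g i * s ^+ i) -> f =1 g.
Proof.
move=> H i.
have E (h : 'I_n -> C) s : \sum_i h i * s ^+ i =
   (\poly_(k < n) (if insub k is Some k' then h k' else 0)).[s].
  rewrite horner_poly; apply: eq_bigr => k _; rewrite valK //.
set pf := \poly_(k < n) (if insub k is Some k' then f k' else 0).
set pg := \poly_(k < n) (if insub k is Some k' then g k' else 0).
suff : pf = pg.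
  by move/(congr1 (fun p : {poly C} => p`_i)); rewrite !coef_poly ltn_ord valK.
apply/eqP; rewrite -subr_eq0; apply/negPn/negP => nz.
(* The naturals below the size of the difference are distinct in characteristic 0, and they are one
   root too many. *)
have := @max_poly_roots C (pf - pg) [seq k%:R | k <- iota 0 (size (pf - pg))] nz.
rewrite size_map size_iota ltnn => F; apply: notF; apply: F.
  apply/allP => x _; rewrite rootE hornerD hornerN -!E H subrr //.
rewrite map_inj_uniq ?iota_uniq // => x y /eqP; rewrite eqr_nat => /eqP //.
Qed.

Lemma eq_poly_coef2 n m (f g : 'I_n -> 'I_m -> C) :
  (forall s r, \sum_i \sum_j f i j * (s ^+ i * r ^+ j) =
               \sum_i \sum_j g i j * (s ^+ i * r ^+ j)) -> f =2 g.
Proof.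
move=> H i; apply: eq_poly_coef => r; move: i; apply: eq_poly_coef => s.
move: (H s r); set A := LHS; set B := RHS => e.
transitivity A; [|rewrite e]; apply: eq_bigr => i _;
  by rewrite mulr_suml; apply: eq_bigr => j _; ring.
Qed.

(** Polarization: both sides of the hypothesis are polynomials in [s] and [r], and the coefficients
    of [s ^+ i * r ^+ j] are compared. The exponents [n] and [m] may differ, with [c = 0] in that
    case, so that the lemma applies again once one variable has been extracted. *)
Lemma coef_moments (I : finType) (G X X' Y Y' : I -> C) (n m : nat) c k l :
  (n != m -> c = 0) ->
  (forall s r, \sum_x G x * ((s * X x + Y x) ^+ n * (r * X' x + Y' x) ^+ m)
               = c * (s * r * k + l) ^+ n) ->
  forall i j, (i <= n)%N -> (j <= m)%N ->
  'C(n, i)%:R * 'C(m, j)%:R *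
   (\sum_x G x * (X x ^+ i * X' x ^+ j * (Y x ^+ (n - i) * Y' x ^+ (m - j))))
   = c * (i == j)%:R * 'C(n, i)%:R * (k ^+ i * l ^+ (n - i)).
Proof.
move=> nm H i j; rewrite -ltnS => ilt; rewrite -ltnS => jlt.
pose f (i : 'I_n.+1) (j : 'I_m.+1) := 'C(n, i)%:R * 'C(m, j)%:R *
   (\sum_x G x * (X x ^+ i * X' x ^+ j * (Y x ^+ (n - i) * Y' x ^+ (m - j)))).
pose g (i : 'I_n.+1) (j : 'I_m.+1) :=
  c * (i == j :> nat)%:R * 'C(n, i)%:R * (k ^+ i * l ^+ (n - i)).
suff: f =2 g by move/(_ (Ordinal ilt) (Ordinal jlt)).
apply: eq_poly_coef2 => s r.
transitivity (c * (s * r * k + l) ^+ n); last first.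
  have [e|/nm c0] := eqVneq n m; last first.
    rewrite c0 mul0r; apply/esym/big1 => a _; apply: big1 => b _.
    by rewrite /g c0 !mul0r.
  rewrite addrC exprDn mulr_sumr; apply: eq_bigr => a _.
  have am : (a < m.+1)%N by rewrite -e.
  rewrite (bigD1 (Ordinal am)) //= big1 ?addr0 => [|b ba]; last first.
    rewrite /g; case: eqVneq => [ab|]; last by rewrite !(mulr0, mul0r).
    by case/eqP: ba; apply/val_inj; rewrite /= ab.
  by rewrite /g /= eqxx mulr1 -(mulr_natr (_ * _)) !exprMn; ring.
rewrite -H.
transitivity (\sum_(i0 < n.+1) \sum_(j0 < m.+1) \sum_x ('C(n, i0)%:R * 'C(m, j0)%:R *
   (G x * (X x ^+ i0 * X' x ^+ j0 * (Y x ^+ (n - i0) * Y' x ^+ (m - j0)))))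
   * (s ^+ i0 * r ^+ j0)).
  by apply: eq_bigr => a _; apply: eq_bigr => b _; rewrite /f mulr_sumr mulr_suml.
under eq_bigr => a _ do rewrite exchange_big /=.
rewrite exchange_big /=; apply: eq_bigr => x _.
rewrite [s * _ + _]addrC [r * _ + _]addrC !exprDn big_distrlr /= mulr_sumr.
apply: eq_bigr => a _; rewrite mulr_sumr; apply: eq_bigr => b _.
by rewrite -!(mulr_natr (_ * _)) !exprMn; ring.
Qed.

(** [coef_moments] is applied twice, the second time with [s2 = r2 = 1]. Equality of the third
    exponents is implied by the two constraints on the sums. *)
Lemma moments3 (I : finType) (w y0 y1 y2 x0 x1 x2 : I -> C) n :
  (forall s0 s1 s2 r0 r1 r2,
     \sum_x w x * ((s0 * y0 x + (s1 * y1 x + s2 * y2 x)) ^+ n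
                  * (r0 * x0 x + (r1 * x1 x + r2 * x2 x)) ^+ n)
     = n`!%:R * (s0 * r0 + (s1 * r1 + s2 * r2)) ^+ n) ->
  forall a0 a1 a2 b0 b1 b2, (a0 + a1 + a2 = n)%N -> (b0 + b1 + b2 = n)%N ->
  \sum_x w x * (y0 x ^+ a0 * x0 x ^+ b0 *
                 (y1 x ^+ a1 * x1 x ^+ b1 * (y2 x ^+ a2 * x2 x ^+ b2))) =
  ((a0 == b0) && (a1 == b1))%:R * (a0`! * a1`! * a2`!)%:R.
Proof.
move=> H a0 a1 a2 b0 b1 b2 ea eb.
have a0n : (a0 <= n)%N by rewrite -ea -addnA leq_addr.
have b0n : (b0 <= n)%N by rewrite -eb -addnA leq_addr.
have Cn (p q : nat) : (q <= p)%N -> 'C(p, q)%:R != 0 :> C.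
  by move=> qp; rewrite pnatr_eq0 -lt0n bin_gt0.
have H1 s1 s2 r1 r2 :
  \sum_x w x * (y0 x ^+ a0 * x0 x ^+ b0 *
    ((s1 * y1 x + s2 * y2 x) ^+ (n - a0) * (r1 * x1 x + r2 * x2 x) ^+ (n - b0)))
  = (a0 == b0)%:R * (a0`! * (n - a0)`!)%:R * (s1 * r1 + s2 * r2) ^+ (n - a0).
  have nn : n != n -> n`!%:R = 0 :> C by rewrite eqxx.
  have H' s r : \sum_x w x * ((s * y0 x + (s1 * y1 x + s2 * y2 x)) ^+ n
                  * (r * x0 x + (r1 * x1 x + r2 * x2 x)) ^+ n)
     = n`!%:R * (s * r * 1 + (s1 * r1 + s2 * r2)) ^+ n by rewrite H mulr1.
  have := coef_moments nn H' a0n b0n.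
  rewrite expr1n mul1r => E.
  apply: (mulfI (Cn _ _ a0n)); apply: (mulfI (Cn _ _ b0n)).
  rewrite mulrCA mulrA E.
  case: eqP => [<-|_]; last by rewrite !(mulr0, mul0r).
  rewrite -(bin_fact a0n) !natrM; ring.
have a1n : (a1 <= n - a0)%N by rewrite -ea -addnA addKn leq_addr.
have b1n : (b1 <= n - b0)%N by rewrite -eb -addnA addKn leq_addr.
have nn : (n - a0 != n - b0)%N ->
    (a0 == b0)%:R * (a0`! * (n - a0)`!)%:R = 0 :> C.
  move=> ne; case: (eqVneq a0 b0) => [e|_]; last by rewrite mul0r.
  by rewrite e eqxx in ne.
have H' s r : \sum_x w x * (y0 x ^+ a0 * x0 x ^+ b0) *
     ((s * y1 x + y2 x) ^+ (n - a0) * (r * x1 x + x2 x) ^+ (n - b0))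
   = (a0 == b0)%:R * (a0`! * (n - a0)`!)%:R * (s * r * 1 + 1) ^+ (n - a0).
  have := H1 s 1 r 1; rewrite !mulr1 => <-; apply: eq_bigr => x _.
  by rewrite !mul1r !mulrA.
have := coef_moments nn H' a1n b1n.
have -> : (n - a0 - a1 = a2)%N by lia.
have -> : (n - b0 - b1 = b2)%N by lia.
rewrite !expr1n mulr1 => E.
apply: (mulfI (Cn _ _ a1n)); apply: (mulfI (Cn _ _ b1n)).
rewrite mulrCA mulrA.
transitivity ('C(n - a0, a1)%:R * 'C(n - b0, b1)%:R * \sum_x (w x * (y0 x ^+ a0 * x0 x ^+ b0) *
   (y1 x ^+ a1 * x1 x ^+ b1 * (y2 x ^+ a2 * x2 x ^+ b2)))).
  by congr (_ * _); apply: eq_bigr => x _; rewrite !mulrA.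
rewrite E.
case: (eqVneq a0 b0) => [e0|_]; last by rewrite !(mulr0, mul0r).
case: (eqVneq a1 b1) => [e1|_]; last by rewrite !(mulr0, mul0r).
rewrite -e0 -e1 -(bin_fact a1n).
have -> : (n - a0 - a1 = a2)%N by lia.
have T : (true : nat)%:R = 1 :> C by [].
rewrite /= ?T !natrM; ring.
Qed.

End GaussianMoments.

(** * Finite Gaussian quadrature and Werner's response functions *)

Local Open Scope sesquilinear_scope.

Lemma big_ord3 (V : nmodType) (F : 'I_3 -> V) :
  \sum_i F i = F 0 + F 1 + F (1 + 1).
Proof.
rewrite !big_ord_recl big_ord0 addr0 addrA.
by congr (F _ + F _ + F _); apply: val_inj.
Qed.

Section Quadrature.
Variable C : numClosedFieldType.

(** A root of [1 + z + ... + z^6] has order dividing 7, and order 1 would make this sum equal to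
    7. *)
Lemma prim7_root_exists : exists z : C, 7.-primitive_root z.
Proof.
have [|z rz] := @closed_rootP C (\poly_(i < 7) 1) _.
  by rewrite size_poly_eq // oner_neq0.
have s0 : \sum_(i < 7) z ^+ i = 0.
  move/rootP: rz; rewrite horner_poly => e; rewrite -[RHS]e.
  by apply: eq_bigr => i _; rewrite mul1r.
have z7 : z ^+ 7 = 1.
  by apply/eqP; rewrite -subr_eq0 subrX1 s0 mulr0.
have [m pm] := prim_order_exists (isT : 0 < 7)%N z7.
rewrite dvdn_divisors // !inE => /orP[|] /eqP e; subst m; last by exists z.
move: s0; rewrite (prim_expr_order pm : z = 1).
under eq_bigr do rewrite expr1n.
by rewrite sumr_const card_ord => /eqP; rewrite pnatr_eq0.
Qed.

Lemma prim_root_conj n (z : C) : n.-primitive_root z -> z^* = z^-1.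
Proof.
move=> pz; have n0 := prim_order_gt0 pz.
have z1 : `|z| = 1.
  apply/eqP; rewrite -(@pexpr_eq1 _ _ n) //.
  by rewrite -normrX (prim_expr_order pz) normr1.
have z0 : z != 0 by rewrite -normr_gt0 z1.
by apply: (mulfI z0); rewrite -normCK z1 expr1n divff.
Qed.

(** Averaging over the phases kills the term unless [n] divides [a - b]; for exponents below [n]
    this leaves only [a = b]. *)
Lemma prim_root_orthogonal n (z : C) a b : n.-primitive_root z ->
  (a < n)%N -> (b < n)%N ->
  \sum_(m < n) (z ^+ m) ^+ a * ((z ^+ m)^*) ^+ b = (a == b)%:R * n%:R.
Proof.
move=> pz an bn.
have z0 : z != 0 by rewrite (prim_root_eq0 pz) -lt0n (leq_ltn_trans _ an).
pose q := z ^+ a / z ^+ b.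
transitivity (\sum_(m < n) q ^+ m).
  apply: eq_bigr => m _; rewrite rmorphXn /= (prim_root_conj pz).
  by rewrite /q exprMn !exprVn -!exprM mulnC [(b * _)%N]mulnC.
have qn : q ^+ n = 1.
  rewrite /q exprMn exprVn -!exprM mulnC [(b * _)%N]mulnC !exprM.
  by rewrite (prim_expr_order pz) !expr1n invr1 mulr1.
case: eqVneq => [ab|nab].
  rewrite /q ab divff ?expf_neq0 // mul1r.
  under eq_bigr do rewrite expr1n.
  by rewrite sumr_const card_ord.
have q1 : q - 1 != 0.
  rewrite subr_eq0 -(inj_eq (mulIf (expf_neq0 b z0))) mulfVK ?expf_neq0 //.
  by rewrite mul1r (eq_prim_root_expr pz) !modn_small.
by apply: (mulfI q1); rewrite -subrX1 qn subrr mul0r mulr0.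
Qed.

(* With t = rad ^ 2 / 4, the seven points t and the positive weights form a
   quadrature rule exact for the moments k!, k <= 6, of exp(-t) dt. *)
Definition rad (t : 'I_7) : nat := nth 0%N [:: 1; 2; 3; 4; 5; 6; 8]%N t.

Definition wt (t : 'I_7) : C :=
  nth 0 [:: 8 * 697 / (243 * 49); 4421 / (567 * 25); 292 / 1575;
            187 / (243 * 28); 1636 / (243 * 1001); 1 / (99 * 49);
            67 / (100 * 243 * 637)] t.

Lemma wt_gt0 t : 0 < wt t.
Proof.
case: t => -[|[|[|[|[|[|[|m]]]]]]] i; last by [].
all: rewrite /wt /=; do ?[apply: divr_gt0 | apply: mulr_gt0].
all: by [rewrite ltr0n | apply: ltr01].
Qed.

Lemma rad_gt0 t : (0 < rad t)%N.
Proof. by case: t => -[|[|[|[|[|[|[|m]]]]]]]. Qed.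

Lemma quadrature a : (a <= 6)%N ->
  \sum_t wt t * ((rad t)%:R / 2) ^+ (a + a) = a`!%:R.
Proof.
rewrite !big_ord_recl big_ord0 /wt /rad /= /bump /=.
by case: a => [|[|[|[|[|[|[|a]]]]]]] //= _; rewrite ?factS fact0 ?natrM; field.
Qed.

Definition qpoint : finType := ('I_7 * 'I_7)%type.
Definition qweight (x : qpoint) : C := wt x.1 / 7.
Definition qvalue (zeta : C) (x : qpoint) : C :=
  (rad x.1)%:R / 2 * zeta ^+ x.2.

Lemma qweight_ge0 x : 0 <= qweight x.
Proof. by rewrite divr_ge0 ?ler0n // ltW // wt_gt0. Qed.

Lemma qvalue_moments zeta : 7.-primitive_root zeta ->
  gauss_moments 6 qweight (qvalue zeta) (fun x => (qvalue zeta x)^*) 1.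
Proof.
move=> pz a b an bn.
rewrite -(pair_bigA _ (fun t m => qweight (t, m) *
  (qvalue zeta (t, m) ^+ a * (qvalue zeta (t, m))^* ^+ b))) /=.
transitivity (\sum_t wt t * ((rad t)%:R / 2) ^+ (a + b) / 7 *
   \sum_(m < 7) (zeta ^+ m) ^+ a * ((zeta ^+ m)^*) ^+ b).
  apply: eq_bigr => t _; rewrite mulr_sumr; apply: eq_bigr => m _.
  rewrite /qweight /qvalue /= rmorphM /= rmorphM /= fmorphV /= !rmorph_nat.
  by rewrite !exprMn !exprD; ring.
under eq_bigr do rewrite prim_root_orthogonal //.
case: eqVneq => [e|_]; last first.
  by rewrite !mul0r; apply: big1 => t _; rewrite mulr0.
subst b; rewrite [RHS]mul1r expr1n [RHS]mulr1 -(quadrature an).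
by apply: eq_bigr => t _; rewrite mul1r divfK // pnatr_eq0.
Qed.

End Quadrature.

(** * Moments of a hidden vector with three independent coordinates *)

Section WernerMoments.
Variable C : numClosedFieldType.

Definition qspace : finType := (qpoint * (qpoint * qpoint))%type.

Definition qspace_weight (x : qspace) : C :=
  qweight C x.1 * (qweight C x.2.1 * qweight C x.2.2).

Definition qvector (zeta : C) (x : qspace) : 'cV[C]_3 :=
  \col_k qvalue zeta (if k == 0 then x.1 else if k == 1 then x.2.1 else x.2.2).

Lemma qspace_weight_ge0 x : 0 <= qspace_weight x.
Proof. exact: mulr_ge0 (qweight_ge0 _ _) (mulr_ge0 (qweight_ge0 _ _) (qweight_ge0 _ _)). Qed.

(** No radius of the quadrature is 0, so normalizing by the squared norm is always legitimate. *)
Lemma qvector_neq0 zeta x : 7.-primitive_root zeta -> qvector zeta x != 0.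
Proof.
move=> pz; apply/eqP => /matrixP/(_ 0 0); rewrite !mxE /= => /eqP.
apply/negP; rewrite /qvalue mulf_neq0 ?expf_neq0 ?(prim_root_eq0 pz) //.
by rewrite mulf_neq0 ?invr_neq0 ?pnatr_eq0 // -lt0n rad_gt0.
Qed.

(** The right-hand side depends on [u] and [v] only through their bilinear pairing, which a unitary
    change of coordinates preserves. *)
Lemma qvector_moments zeta (u v : 'I_3 -> C) : 7.-primitive_root zeta ->
  \sum_x qspace_weight x * ((\sum_k u k * qvector zeta x k 0) ^+ 6 *
                            (\sum_k v k * (qvector zeta x k 0)^*) ^+ 6)
  = 6`!%:R * (\sum_k u k * v k) ^+ 6.
Proof.
move=> pz.
have G k := gauss_scale (u k) (v k) (qvalue_moments pz).
have := gauss_add (G 0) (gauss_add (G 1) (G (1 + 1))).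
move=> /(_ 6 6 isT isT)%N; rewrite eqxx mul1r !mulr1 => E.
rewrite big_ord3 -addrA -E.
by apply: eq_bigr => x _; rewrite !big_ord3 !mxE /= !addrA.
Qed.

Variables (zeta : C) (P : 'M[C]_3).
Hypotheses (zeta_prim : 7.-primitive_root zeta) (P_unitary : P *m P^t* = 1%:M).

(** The rows of [P] are the bras [<e_i|] of an orthonormal basis, so this is [<e_i|psi>]. *)
Definition amp (i : 'I_3) (x : qspace) : C := (P *m qvector zeta x) i 0.

Lemma amp_generating (i0 i1 i2 : 'I_3) (s0 s1 s2 r0 r1 r2 : C) :
  uniq [:: i0; i1; i2] ->
  \sum_x qspace_weight x * ((s0 * amp i0 x + (s1 * amp i1 x + s2 * amp i2 x)) ^+ 6
        * (r0 * (amp i0 x)^* + (r1 * (amp i1 x)^* + r2 * (amp i2 x)^*)) ^+ 6)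
  = 6`!%:R * (s0 * r0 + (s1 * r1 + s2 * r2)) ^+ 6.
Proof.
rewrite /= !inE negb_or andbT => /andP[/andP[n01 n02] n12].
have o i j : \sum_k P i k * (P j k)^* = (i == j)%:R.
  move/matrixP: P_unitary => /(_ i j); rewrite !mxE => <-.
  by apply: eq_bigr => k _; rewrite !mxE.
pose u k := s0 * P i0 k + (s1 * P i1 k + s2 * P i2 k).
pose v k := r0 * (P i0 k)^* + (r1 * (P i1 k)^* + r2 * (P i2 k)^*).
transitivity (6`!%:R * (\sum_k u k * v k) ^+ 6).
  rewrite -(qvector_moments u v zeta_prim); apply: eq_bigr => x _.
  congr (_ * (_ ^+ 6 * _ ^+ 6)).
    rewrite /amp !mxE !mulr_sumr -!big_split /=.
    by apply: eq_bigr => k _; rewrite /u; ring.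
  rewrite /amp !mxE !rmorph_sum !mulr_sumr -!big_split /=.
  by apply: eq_bigr => k _; rewrite /v !rmorphM; ring.
congr (_ * _ ^+ _).
transitivity (s0 * r0 * (i0 == i0)%:R + s0 * r1 * (i0 == i1)%:R
   + s0 * r2 * (i0 == i2)%:R + s1 * r0 * (i1 == i0)%:R
   + s1 * r1 * (i1 == i1)%:R + s1 * r2 * (i1 == i2)%:R
   + s2 * r0 * (i2 == i0)%:R + s2 * r1 * (i2 == i1)%:R
   + s2 * r2 * (i2 == i2)%:R).
  rewrite -!o !mulr_sumr -!big_split /=.
  by apply: eq_bigr => k _; rewrite /u /v; ring.
rewrite !eqxx !mulr1 (eq_sym i1 i0) (eq_sym i2 i0) (eq_sym i2 i1).
rewrite (negPf n01) (negPf n02) (negPf n12) !mulr0; ring.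
Qed.

(* Up to the normalization (a + b + c) ^ 5, Alice answers i with probability
   werner_poly x_i x_j x_k / 2, where x_0, x_1, x_2 are the squared moduli of
   the coordinates of the hidden vector. Draw five indices at random with law
   proportional to x; the answer is the least frequent index, except that after
   a draw of type (2, 2, 1) it is a uniformly random index half of the time. *)
Definition werner_poly (a b c : C) : C :=
  2 * (b + c) ^+ 5 - (b ^+ 5 + c ^+ 5)
  + 10 * (a * b * c) * (b + c) * (a + 2 * b + 2 * c).

Definition werner_coefs : seq (nat * (nat * nat * nat)) :=
  [:: (1, (0, 5, 0)); (10, (0, 4, 1)); (20, (0, 3, 2)); (20, (0, 2, 3));
      (10, (0, 1, 4)); (1, (0, 0, 5)); (10, (2, 2, 1)); (10, (2, 1, 2));
      (20, (1, 3, 1)); (40, (1, 2, 2)); (20, (1, 1, 3))]%N.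

Lemma werner_polyE a b c : werner_poly a b c =
  \sum_(q <- werner_coefs) q.1%:R * (a ^+ q.2.1.1 * (b ^+ q.2.1.2 * c ^+ q.2.2)).
Proof. by rewrite /werner_coefs !big_cons big_nil /= /werner_poly; ring. Qed.

Lemma werner_poly_sum a b c :
  werner_poly a b c + werner_poly b c a + werner_poly c a b
  = 2 * (a + b + c) ^+ 5.
Proof. by rewrite /werner_poly; ring. Qed.

Lemma werner_poly_ge0 a b c : 0 <= a -> 0 <= b -> 0 <= c ->
  0 <= werner_poly a b c.
Proof.
move=> a0 b0 c0; rewrite werner_polyE.
by apply: sumr_ge0 => q _; rewrite !mulr_ge0 ?exprn_ge0 // ler0n.
Qed.

Definition werner_prob (i : 'I_3) (x : 'I_3 -> C) :=
  werner_poly (x i) (x (i + 1)) (x (i + (1 + 1))).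

(** A monomial of [werner_poly] times one more coordinate and one more conjugate coordinate is a
    moment of bidegree (6, 6): it vanishes unless [d = e], and is then a product of three
    factorials. The ratio 1120 : 2800 is the required 2 : 5; without the random answers after draws
    of type (2, 2, 1) it would be 18 : 47. *)
Lemma werner_moment (i d e : 'I_3) :
  \sum_x qspace_weight x * (werner_prob i (fun k => amp k x * (amp k x)^*) *
      (amp (i + d) x * (amp (i + e) x)^*))
  = (d == e)%:R * (2 * (if d == 0 then 1120 else 2800)).
Proof.
have u : uniq [:: i; i + 1; i + (1 + 1)].
  by case: i => -[|[|[|m]]].
have := fun s0 s1 s2 r0 r1 r2 => amp_generating s0 s1 s2 r0 r1 r2 u.
move/moments3 => M.
pose t0 (d' : 'I_3) : nat := d' == 0; pose t1 (d' : 'I_3) : nat := d' == 1.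
pose t2 (d' : 'I_3) : nat := d' == 1 + 1.
have td d' : (t0 d' + t1 d' + t2 d' = 1)%N.
  by case: d' => -[|[|[|m]]].
(* The extra coordinate, whose index is variable, is written as a monomial in the three fixed
   ones. *)
have pick (d' : 'I_3) (z : 'I_3 -> C) : z (i + d') =
    z i ^+ t0 d' * (z (i + 1) ^+ t1 d' * z (i + (1 + 1)) ^+ t2 d').
  rewrite /t0 /t1 /t2; case: d' => -[|[|[|m]]] // h; rewrite /= ?expr0 ?expr1 ?mulr1 ?mul1r;
    by congr z; apply: val_inj; case: (i) => -[|[|[|]]].
transitivity (\sum_(q <- werner_coefs) q.1%:R * (\sum_x qspace_weight x *
    (amp i x ^+ (q.2.1.1 + t0 d) * (amp i x)^* ^+ (q.2.1.1 + t0 e) *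
    (amp (i + 1) x ^+ (q.2.1.2 + t1 d) * (amp (i + 1) x)^* ^+ (q.2.1.2 + t1 e) *
    (amp (i + (1 + 1)) x ^+ (q.2.2 + t2 d)
      * (amp (i + (1 + 1)) x)^* ^+ (q.2.2 + t2 e)))))).
  under [RHS]eq_bigr do rewrite mulr_sumr.
  rewrite exchange_big /=; apply: eq_bigr => x _.
  rewrite /werner_prob werner_polyE mulr_suml mulr_sumr; apply: eq_bigr => q _.
  rewrite (pick d (amp^~ x)) (pick e (fun k => (amp k x)^*)) !exprMn !exprD.
  by ring.
transitivity (\sum_(q <- werner_coefs) q.1%:R *
   (((q.2.1.1 + t0 d == q.2.1.1 + t0 e) &&
     (q.2.1.2 + t1 d == q.2.1.2 + t1 e))%N%:R *
    ((q.2.1.1 + t0 d)`! * (q.2.1.2 + t1 d)`! * (q.2.2 + t2 d)`!)%N%:R : C)).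
  have s6 (a b c p q r : nat) : (a + b + c == 5 -> p + q + r = 1 ->
      a + p + (b + q) + (c + r) = 6)%N by move=> /eqP; lia.
  rewrite big_seq [RHS]big_seq; apply: eq_bigr => q qin.
  have q5 : (q.2.1.1 + q.2.1.2 + q.2.2 == 5)%N by move: q qin; apply/allP.
  by rewrite M ?s6.
under eq_bigr do rewrite !eqn_add2l.
have -> : (t0 d == t0 e) && (t1 d == t1 e) = (d == e).
  by case: d => -[|[|[|?]]] //; case: e => -[|[|[|?]]].
case: (d == e); last by rewrite mul0r; apply: big1 => q _; rewrite mul0r mulr0.
under eq_bigr do rewrite mul1r -natrM.
rewrite mul1r -natr_sum /werner_coefs !big_cons big_nil /=.
transitivity ((2 * (if d == 0%R then 1120 else 2800))%N%:R : C); last first.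
  by rewrite natrM; case: (d == 0).
congr (_%:R); rewrite /t0 /t1 /t2.
by case: d => -[|[|[|m]]] h //; vm_compute.
Qed.

End WernerMoments.

(** * Finite hidden variables *)

Local Open Scope classical_set_scope.
Local Open Scope ring_scope.
Local Open Scope complex_scope.

Section FiniteHiddenVariable.
Variable R : realType.
Local Notation C := R[i].

Lemma ge0_ReK (z : C) : 0 <= z -> (complex.Re z)%:C = z.
Proof. by case: z => a b; rewrite lecE /= => /andP[/eqP -> _]. Qed.

Lemma Re_ge0 (z : C) : 0 <= z -> 0 <= complex.Re z.
Proof. by case: z => a b; rewrite lecE /= => /andP[]. Qed.

(** The measure is a sum of weighted Dirac masses on [nat], where every set is measurable; the
    measurability clauses of the models built on it are then trivial. *)
Lemma finite_probability (n : nat) (w : 'I_n -> R) :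
  (forall i, 0 <= w i) -> \sum_i w i = 1 ->
  exists q : probability nat R, forall f : nat -> R, (forall k, 0 <= f k) ->
    Rintegral q [set: nat] f = \sum_i w i * f i.
Proof.
move=> w0 w1.
(* The masses form a family over all of [nat]: the default beyond [n] is 0, and the absolute value,
   which does not change [w], supplies the proof of nonnegativity. *)
pose v (k : nat) : {nonneg R} := NngNum (normr_ge0 (oapp w 0 (insub k))).
have vE (i : 'I_n) : (v i)%:num = w i by rewrite /v /= valK /= ger0_norm.
pose mu := msum (fun k => mscale (v k) \d_k) n.
have muT : (mu [set: nat] = 1)%E.
  transitivity (\sum_(i < n) (w i)%:E)%E; last by rewrite sumEFin w1.
  apply: eq_bigr => i _; rewrite -vE.
  by apply: (etrans _ (mule1 _)); congr (_ * _)%E; exact: diracT.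
pose q : probability nat R :=
  HB.pack (msum (fun k => mscale (v k) \d_k) n)
    (@Measure_isProbability.Build _ _ R mu muT).
exists q => f f0.
transitivity (fine (\int[mu]_x (f x)%:E)%E); first by [].
rewrite ge0_integral_measure_sum //; last first.
  by move=> k _; rewrite lee_fin.
transitivity (fine (\sum_(i < n) (w i * f i)%:E)); last by rewrite sumEFin.
congr fine; apply: eq_bigr => i _.
rewrite ge0_integral_mscale //; last by move=> k _; rewrite lee_fin.
by rewrite integral_dirac // diracT mul1e vE.
Qed.

(** This is the passage from finite sums over [R[i]], where the quantum computations take place, to
    the real integrals required of a model. *)
Lemma finite_hidden_variable (I : finType) (w : I -> C) :
  (forall i, 0 <= w i) -> \sum_i w i = 1 ->
  exists (q : probability nat R) (g : nat -> I),
    forall f : I -> R, (forall i, 0 <= f i) ->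
    \sum_i w i * (f i)%:C = (Rintegral q [set: nat] (fun k => f (g k)))%:C.
Proof.
move=> w0 w1.
have /card_gt0P[i0 _] : (0 < #|I|)%N.
  rewrite lt0n; apply/eqP => I0; move: w1.
  rewrite big_pred0 => [|i]; last by have := card0_eq I0 i.
  by move/eqP; rewrite eq_sym oner_eq0.
pose v (k : 'I_#|I|) := complex.Re (w (enum_val k)).
have vE k : (v k)%:C = w (enum_val k) by rewrite /v ge0_ReK.
have [||q qE] := @finite_probability #|I| v.
- by move=> k; apply: Re_ge0.
- apply: (@complexI R); rewrite rmorph_sum rmorph1 -w1.
  rewrite [RHS](reindex (@enum_val I I)) /=; last first.
    by apply: onW_bij; exact: enum_val_bij.
  by apply: eq_bigr => k _; exact: vE.
(* Naturals beyond [#|I|] decode to [i0]; they do not contribute to the integral. *)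
pose g (k : nat) := nth i0 (enum I) k.
exists q, g => f f0; rewrite qE // rmorph_sum.
rewrite (reindex (@enum_val I I)) /=; last first.
  by apply: onW_bij; exact: enum_val_bij.
apply: eq_bigr => k _; rewrite rmorphM /= -vE; congr (_ * (f _)%:C).
by rewrite /g (enum_val_nth i0).
Qed.

End FiniteHiddenVariable.

(** * Traces and projective measurements *)

Section Tensor.
Variable K : comPzRingType.

Lemma mxtrace_tens m n (A : 'M[K]_m) (B : 'M[K]_n) :
  \tr (A *t B) = \tr A * \tr B.
Proof. by rewrite /mxtrace mulr_sum; apply: eq_bigr => i _; rewrite mxE. Qed.

Lemma tens1mx1 m n : (1%:M : 'M[K]_m) *t (1%:M : 'M[K]_n) = 1%:M.
Proof.
apply/matrixP => i j; case: (mxtens_indexP i) => i0 i1.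
case: (mxtens_indexP j) => j0 j1; rewrite tensmxE !mxE -natrM mulnb.
by rewrite (inj_eq (can_inj (@mxtens_indexK _ _))) xpair_eqE.
Qed.

Lemma tr_mul_delta n (A : 'M[K]_n) i j : \tr (delta_mx i j *m A) = A j i.
Proof.
rewrite /mxtrace (bigD1 i) //= big1 ?addr0 => [|k ki].
  rewrite mxE (bigD1 j) //= big1 ?addr0 => [|k kj].
    by rewrite mxE !eqxx mul1r.
  by rewrite mxE (negPf kj) andbF mul0r.
by rewrite mxE big1 // => h _; rewrite mxE (negPf ki) mul0r.
Qed.

End Tensor.

Section Locality.
Variable R : realType.
Local Notation C := R[i].

Lemma rho_ABE : rho_AB R = 2^-1 *: (proj0 R *t proj0 R)
   + (5 / 72) *: 1%:M - 24^-1 *: swap_op R 3.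
Proof.
rewrite /rho_AB /rho_W /P_anti.
move: (proj0 R *t proj0 R) (1%:M : 'M[C]_(3 * 3)) (swap_op R 3) => X Y V.
by apply/matrixP => i j; rewrite !mxE; field.
Qed.

Lemma tr_swap_tens d (A B : 'M[C]_d) : \tr (swap_op R d *m (A *t B)) = \tr (A *m B).
Proof.
rewrite [RHS]mxtrace_mulC /swap_op mulmx_suml raddf_sum /=.
rewrite [RHS]/(mxtrace _); apply: eq_bigr => i _; rewrite mulmx_suml raddf_sum mxE.
apply: eq_bigr => j _ /=.
by rewrite tensmx_mul mxtrace_tens !tr_mul_delta mulrC.
Qed.

Lemma tr_rho_AB (A B : 'M[C]_3) : \tr (rho_AB R *m (A *t B)) =
  2^-1 * (A 0 0 * B 0 0) + 5 / 72 * (\tr A * \tr B) - 24^-1 * \tr (A *m B).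
Proof.
rewrite rho_ABE mulmxBl mulmxDl -!scalemxAl mul1mx linearB linearD /= !linearZ /=.
by rewrite tr_swap_tens tensmx_mul !mxtrace_tens !tr_mul_delta.
Qed.

Lemma hermsymmxP d (A : 'M[C]_d) : reflect (A = A^t*) (A \is hermsymmx).
Proof. by apply: (iffP (is_hermitianmxP _ _ _)); rewrite expr0 scale1r. Qed.

(** With the outcomes encoded as distinct real numbers, the single Hermitian matrix
    [A = \sum_a enc a *: M a] carries the whole measurement. Its spectral basis diagonalizes every
    [M a], and [l i] is the outcome to which the i-th basis vector belongs. *)
Lemma projective_basis d (O : finType) (M : O -> 'M[C]_d) : projective M ->
  exists (P : 'M[C]_d) (l : 'I_d -> O), P *m P^t* = 1%:M /\
    forall a, M a = P^t* *m diag_mx (\row_i (l i == a)%:R) *m P.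
Proof.
move=> [Mh MM M1].
pose enc (a : O) : C := (enum_rank a)%:R.
have enc_inj : injective enc.
  by move=> a b /eqP; rewrite eqr_nat => /eqP/val_inj/enum_rank_inj.
pose A := \sum_a enc a *: M a.
have AM b : A *m M b = enc b *: M b.
  rewrite /A mulmx_suml (bigD1 b) //= big1 ?addr0 => [|a ab].
    by rewrite -scalemxAl MM eqxx.
  by rewrite -scalemxAl MM (negPf ab) scaler0.
have Ah : A \is hermsymmx.
  apply/hermsymmxP; rewrite /A !raddf_sum /=; apply: eq_bigr => a _.
  rewrite linearZ /= map_mxZ /= rmorph_nat; congr (_ *: _).
  exact/hermsymmxP.
set P := spectralmx A; set D := spectral_diag A.
have Pu : P \is unitarymx by apply: spectral_unitarymx.
have PP : P *m P^t* = 1%:M by apply/unitarymxP.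
have PP' : P^t* *m P = 1%:M by apply: mulmx1C.
have PA : P *m A = diag_mx D *m P.
  have /orthomx_spectralP {1}-> := hermitian_normalmx Ah.
  by rewrite invmx_unitary // !mulmxA PP mul1mx.
(* Multiplying by [A] scales this entry both by [D 0 i] and by [enc b], so a nonzero entry
   identifies the eigenvalue. *)
have key i k b : (P *m M b) i k != 0 -> D 0 i = enc b.
  move=> nz; have : P *m A *m M b = enc b *: (P *m M b).
    by rewrite -mulmxA AM scalemxAr.
  rewrite PA -mulmxA => /matrixP/(_ i k); rewrite mul_diag_mx !mxE.
  by move/mulIf; apply; move: nz; rewrite mxE.
have PM i k : P i k = \sum_b (P *m M b) i k.
  by rewrite -[in LHS](mulmx1 P) -M1 mulmx_sumr summxE.
(* Otherwise row [i] of [P] would vanish, since the [M b] sum to 1, against unitarity. *)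
have lab i : exists b, D 0 i == enc b.
  have [[b bk]|nob] := pselect (exists b, D 0 i == enc b); first by exists b.
  exfalso; move/matrixP: PP => /(_ i i); rewrite !mxE eqxx big1.
    by move/eqP; rewrite eq_sym oner_eq0.
  move=> k _; rewrite PM big1 ?mul0r // => b _; apply/eqP/negPn/negP.
  by move=> /key e; apply: nob; exists b; rewrite e.
pose l i := xchoose (lab i).
have lP i : D 0 i = enc (l i) by apply/eqP/(xchooseP (lab i)).
have out i k b : l i != b -> (P *m M b) i k = 0.
  move=> lb; apply/eqP/negPn/negP => /key; rewrite lP => /enc_inj e.
  by rewrite e eqxx in lb.
exists P, l; split => // a.
rewrite -mulmxA -[LHS]mul1mx -PP' -mulmxA; congr (_ *m _).
apply/matrixP => i k; rewrite mul_diag_mx [RHS]mxE [X in X * _]mxE.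
have [<-|ne] := eqVneq (l i) a; last by rewrite mul0r out.
rewrite mul1r PM (bigD1 (l i)) //= big1 ?addr0 // => b.
by rewrite eq_sym; apply: out.
Qed.

End Locality.

(** * The local model *)

Section LocalModel.
Variable R : realType.
Local Notation C := R[i].

Definition expect d (u : 'cV[C]_d) (A : 'M[C]_d) : C := (u^t* *m A *m u) 0 0.
Definition nsq d (u : 'cV[C]_d) : C := (u^t* *m u) 0 0.

Lemma nsqE d (u : 'cV[C]_d) : nsq u = \sum_k `|u k 0| ^+ 2.
Proof.
by rewrite /nsq mxE; apply: eq_bigr => k _; rewrite !mxE normCK mulrC.
Qed.

Lemma nsq_ge0 d (u : 'cV[C]_d) : 0 <= nsq u.
Proof. by rewrite nsqE sumr_ge0 // => k _; rewrite exprn_ge0. Qed.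

Lemma nsq_gt0 d (u : 'cV[C]_d) : u != 0 -> 0 < nsq u.
Proof.
move=> u0; rewrite lt_neqAle nsq_ge0 andbT eq_sym; apply: contra u0.
rewrite nsqE psumr_eq0 => [/allP H|k _]; last by rewrite exprn_ge0.
apply/eqP/matrixP => i j; rewrite ord1 mxE; apply/eqP.
by have := H i (mem_index_enum _); rewrite expf_eq0 normr_eq0.
Qed.

Lemma expect_scale1 d (u : 'cV[C]_d) : expect u 1%:M = nsq u.
Proof. by rewrite /expect mulmx1. Qed.

Lemma expect_sum d (u : 'cV[C]_d) (I : finType) (M : I -> 'M[C]_d) :
  expect u (\sum_a M a) = \sum_a expect u (M a).
Proof. by rewrite /expect mulmx_sumr mulmx_suml summxE. Qed.

Lemma gram_psd d m (B : 'M[C]_(m, d)) : psd (B^t* *m B).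
Proof.
move=> u; rewrite mulmxA -mulmxA.
have -> : u^t* *m B^t* = (B *m u)^t* by rewrite trmx_mul map_mxM.
exact: nsq_ge0.
Qed.

Lemma projector_psd d (A : 'M[C]_d) : A \is hermsymmx -> A *m A = A -> psd A.
Proof. by move=> /hermsymmxP h e; rewrite -e {1}h; apply: gram_psd. Qed.

Lemma projective_psd d (O : finType) (M : O -> 'M[C]_d) a :
  projective M -> psd (M a).
Proof. by move=> [h p _]; apply: projector_psd; rewrite // p eqxx. Qed.

Lemma expect_delta (A : 'M[C]_3) : expect (delta_mx 0 0) A = A 0 0.
Proof.
rewrite /expect trmx_delta map_delta_mx -rowE -colE.
by rewrite !mxE.
Qed.

Variable zeta : C.
Hypothesis zeta_prim : 7.-primitive_root zeta.

Section Basis.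
Variables (P : 'M[C]_3).
Hypothesis P_unitary : P *m P^t* = 1%:M.

Let prob (i : 'I_3) (x : qspace) : C :=
  werner_prob i (fun k => amp zeta P k x * (amp zeta P k x)^*).

Lemma unitary_adjK : P^t* *m P = 1%:M. Proof. exact: mulmx1C. Qed.

Lemma expect_basis (x : qspace) (N : 'M[C]_3) :
  expect (qvector zeta x) N =
  \sum_j \sum_k (P *m N *m P^t*) k j * (amp zeta P j x * (amp zeta P k x)^*).
Proof.
set psi := qvector zeta x; set y := P *m psi.
have -> : psi = P^t* *m y by rewrite mulmxA unitary_adjK mul1mx.
rewrite /amp -/psi -/y /expect trmx_mul map_mxM /= trmxCK -!mulmxA.
rewrite !(mulmxA P) (mulmxA (P *m N)) (mulmxA (y^t*)).
move: y (P *m N *m P^t*) => y n; rewrite mxE; apply: eq_bigr => j _.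
by rewrite mxE mulr_suml; apply: eq_bigr => k _; rewrite !mxE; ring.
Qed.

Lemma nsq_basis (x : qspace) :
  nsq (qvector zeta x) = \sum_k amp zeta P k x * (amp zeta P k x)^*.
Proof.
rewrite -expect_scale1 expect_basis mulmx1 P_unitary; apply: eq_bigr => j _.
rewrite (bigD1 j) //= big1 ?addr0 => [|k kj]; first by rewrite mxE eqxx mul1r.
by rewrite mxE (negPf kj) mul0r.
Qed.

Lemma prob_ge0 i x : 0 <= prob i x.
Proof. by rewrite werner_poly_ge0 // mul_conjC_ge0. Qed.

Lemma prob_sum x : \sum_i prob i x = 2 * nsq (qvector zeta x) ^+ 5.
Proof.
rewrite big_ord3 nsq_basis big_ord3 /prob /werner_prob !add0r.
have -> : (1 + 1 + 1 : 'I_3) = 0 by apply: val_inj.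
have -> : (1 + (1 + 1) : 'I_3) = 0 by apply: val_inj.
have -> : (1 + 1 + (1 + 1) : 'I_3) = 1 by apply: val_inj.
by rewrite werner_poly_sum.
Qed.

Lemma werner_moment2 (i j k : 'I_3) :
  \sum_x qspace_weight C x * (prob i x * (amp zeta P j x * (amp zeta P k x)^*))
  = (j == k)%:R * (2 * (if j == i then 1120 else 2800)).
Proof.
have := werner_moment zeta_prim P_unitary i (j - i) (k - i).
by rewrite !(addrC i) !subrK (inj_eq (addIr _)) subr_eq0.
Qed.

(** Only the diagonal of [N] in Alice's basis contributes: 2800 for each entry, lowered by 1680 =
    2800 - 1120 at her own index. *)
Lemma werner_expect (i : 'I_3) (N : 'M[C]_3) :
  \sum_x qspace_weight C x * (prob i x * expect (qvector zeta x) N)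
  = 2 * (2800 * \tr N - 1680 * (P *m N *m P^t*) i i).
Proof.
have -> : \tr N = \sum_j (P *m N *m P^t*) j j.
  by rewrite -[RHS]/(\tr _) mxtrace_mulC mulmxA unitary_adjK mul1mx.
transitivity (\sum_j \sum_k (P *m N *m P^t*) k j *
   ((j == k)%:R * (2 * (if j == i then 1120 else 2800)))).
  transitivity (\sum_x \sum_j \sum_k (P *m N *m P^t*) k j *
     (qspace_weight C x * (prob i x * (amp zeta P j x * (amp zeta P k x)^*)))).
    apply: eq_bigr => x _; rewrite expect_basis !mulr_sumr; apply: eq_bigr => j _.
    by rewrite !mulr_sumr; apply: eq_bigr => k _; ring.
  rewrite exchange_big; apply: eq_bigr => j _.
  rewrite exchange_big; apply: eq_bigr => k _.
  by rewrite -mulr_sumr werner_moment2.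
set n := P *m N *m P^t*.
transitivity (\sum_j n j j * (2 * (if j == i then 1120 else 2800))).
  apply: eq_bigr => j _; rewrite (bigD1 j) //= big1 ?addr0 => [|k kj].
    by rewrite eqxx mul1r.
  by rewrite eq_sym (negPf kj) mul0r mulr0.
rewrite (bigD1 i) //= eqxx [in RHS](bigD1 i) //=.
rewrite (eq_bigr (fun j => n j j * (2 * 2800))) => [|j /negPf ->] //.
rewrite -mulr_suml; ring.
Qed.

End Basis.

(** The value 20160 = 8!/2! is the sixth moment of the squared norm of a standard Gaussian vector of
    [C^3]. It comes for free by summing [werner_expect] over Alice's answers with [N = 1]. *)
Lemma nsq_moment :
  \sum_x qspace_weight C x * nsq (qvector zeta x) ^+ 6 = 20 * 1008.
Proof.
have U : (1%:M : 'M[C]_3) *m 1%:M^t* = 1%:M.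
  by rewrite mul1mx trmx1 map_mx1.
have : \sum_i \sum_x qspace_weight C x * (werner_prob i (fun k => amp zeta 1%:M k x
     * (amp zeta 1%:M k x)^*) * expect (qvector zeta x) 1%:M) = 2 * (20 * 1008).
  under eq_bigr do rewrite werner_expect // mulmx1 U mxtrace1 mxE eqxx.
  by rewrite sumr_const card_ord mulr1n -(mulr_natr (2 * _)); ring.
rewrite exchange_big /= => E.
apply: (@mulfI _ 2); rewrite ?pnatr_eq0 // -E mulr_sumr; apply: eq_bigr => x _.
by rewrite -mulr_sumr -mulr_suml prob_sum // expect_scale1; ring.
Qed.

(** [None] is the component [|00><00|], for which the hidden vector is [|0>]; [Some x] belongs to
    the Werner half. *)
Definition hidden_weight (h : option qspace) : C :=
  if h is Some x then
    2^-1 * (qspace_weight C x * nsq (qvector zeta x) ^+ 6 / (20 * 1008))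
  else 2^-1.

Definition hidden_vector (h : option qspace) : 'cV[C]_3 :=
  if h is Some x then qvector zeta x else delta_mx 0 0.

Definition quantum_response (N : 'M[C]_3) (h : option qspace) : C :=
  expect (hidden_vector h) N / nsq (hidden_vector h).

Lemma big_option (V : nmodType) (I : finType) (F : option I -> V) :
  \sum_h F h = F None + \sum_i F (Some i).
Proof.
rewrite (bigD1 None) //=; congr (_ + _).
rewrite (reindex_omap Some id) //=; last by case.
by apply: eq_bigl => i; rewrite eqxx.
Qed.

Lemma hidden_weight_ge0 h : 0 <= hidden_weight h.
Proof.
case: h => [x|] /=; last by rewrite invr_ge0 ler0n.
apply: mulr_ge0; first by rewrite invr_ge0 ler0n.
apply: divr_ge0; last by rewrite mulr_ge0 ?ler0n.
by apply: mulr_ge0; [exact: qspace_weight_ge0 | rewrite exprn_ge0 ?nsq_ge0].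
Qed.

Lemma hidden_weight_sum : \sum_h hidden_weight h = 1.
Proof.
rewrite big_option /= -mulr_sumr -mulr_suml nsq_moment divff; first by field.
by rewrite mulf_neq0 // pnatr_eq0.
Qed.

Lemma hidden_vector_gt0 h : 0 < nsq (hidden_vector h).
Proof.
apply: nsq_gt0; case: h => [x|] /=; first exact: qvector_neq0.
by apply/eqP => /matrixP/(_ 0 0)/eqP; rewrite !mxE oner_eq0.
Qed.

Lemma quantum_response_ge0 N h : psd N -> 0 <= quantum_response N h.
Proof. by move=> pN; rewrite divr_ge0 ?nsq_ge0 ?pN. Qed.

Lemma quantum_response_sum (O : finType) (N : O -> 'M[C]_3) h :
  projective N -> \sum_b quantum_response (N b) h = 1.
Proof.
move=> [_ _ N1]; rewrite -mulr_suml -expect_sum N1 expect_scale1 divff //.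
exact/lt0r_neq0/hidden_vector_gt0.
Qed.

(** Alice answers for the rank-one refinement given by the basis, then coarse-grains along [l]. *)
Definition alice_response (P : 'M[C]_3) (O : finType) (l : 'I_3 -> O)
    (M : O -> 'M[C]_3) (a : O) (h : option qspace) : C :=
  if h is Some x then
    (\sum_(i | l i == a) werner_prob i (fun k => amp zeta P k x * (amp zeta P k x)^*))
    / (2 * nsq (qvector zeta x) ^+ 5)
  else quantum_response (M a) h.

Lemma alice_model (O : finType) (M : O -> 'M[C]_3) : projective M ->
  exists f : O -> option qspace -> C,
    [/\ forall a h, 0 <= f a h, forall h, \sum_a f a h = 1 &
        forall a N, \sum_h hidden_weight h * (f a h * quantum_response N h)
                    = \tr (rho_AB R *m (M a *t N))].
Proof.
move=> pM; have [P [l [PP ME]]] := projective_basis pM.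
exists (alice_response P l M); split.
- move=> a [x|] /=; last by apply: quantum_response_ge0; apply: projective_psd.
  rewrite divr_ge0 ?mulr_ge0 ?ler0n ?exprn_ge0 ?nsq_ge0 // sumr_ge0 // => i _.
  exact: prob_ge0.
- move=> [x|]; last exact: quantum_response_sum.
  have := prob_sum PP x; rewrite (partition_big l predT) //= => ps.
  rewrite /= -mulr_suml ps divff //.
  rewrite mulf_neq0 ?pnatr_eq0 // expf_neq0 //.
  exact/lt0r_neq0/(hidden_vector_gt0 (Some x)).
- move=> a N; rewrite big_option /= tr_rho_AB.
  rewrite /quantum_response /= !expect_delta.
  have -> : nsq (delta_mx 0 0 : 'cV[C]_3) = 1.
    by rewrite -expect_scale1 expect_delta mxE.
  rewrite !divr1 -addrA; congr (_ + _).
  (* Here 160 * 504 = 2 * 2 * 20160: the weight 1/2 of the Werner half, the factor 2 in the sum of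
     the [werner_poly], and the normalization of the weights. *)
  transitivity (\sum_(i | l i == a) \sum_x (160 * 504)^-1 *
     (qspace_weight C x * (werner_prob i (fun k => amp zeta P k x
       * (amp zeta P k x)^*) * expect (qvector zeta x) N))).
    rewrite exchange_big /=; apply: eq_bigr => x _.
    have := lt0r_neq0 (hidden_vector_gt0 (Some x)) => /= n0.
    rewrite -!mulr_sumr -mulr_suml.
    move: (\sum_(i | _) _) (nsq _) n0 => p s s0; field; rewrite s0 /=.
    by [].
  under eq_bigr do rewrite -mulr_sumr werner_expect //.
  have -> : \tr (M a) = \sum_(i | l i == a) 1.
    rewrite ME mxtrace_mulC mulmxA PP mul1mx mxtrace_diag [RHS]big_mkcond /=.
    by apply: eq_bigr => i _; rewrite mxE; case: (l i == a).
  have -> : \tr (M a *m N) = \sum_(i | l i == a) (P *m N *m P^t*) i i.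
    have -> : M a *m N = P^t* *m (diag_mx (\row_i (l i == a)%:R) *m (P *m N)).
      by rewrite ME !mulmxA.
    rewrite mxtrace_mulC -(mulmxA (diag_mx _)) [RHS]big_mkcond /=.
    rewrite /mxtrace; apply: eq_bigr => i _.
    rewrite mul_diag_mx mxE [X in X * _]mxE.
    by case: (l i == a); rewrite ?mul1r ?mul0r.
  move: (\tr N) => t; rewrite mulr_suml !mulr_sumr -sumrB; apply: eq_bigr => i _.
  by field.
Qed.

Lemma local_projective_rho_AB : local_projective (rho_AB R).
Proof.
have [q [g qE]] := finite_hidden_variable hidden_weight_ge0 hidden_weight_sum.
(* Projectivity is placed inside the existential because a model is a total function of [M],
   obtained by choice. *)
have ex (O : finType) (M : O -> 'M[C]_3) :
    exists f : O -> option qspace -> C, projective M ->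
    [/\ forall a h, 0 <= f a h, forall h, \sum_a f a h = 1 &
        forall a N, \sum_h hidden_weight h * (f a h * quantum_response N h)
                    = \tr (rho_AB R *m (M a *t N))].
  have [/alice_model[f fP]|nM] := pselect (projective M); first by exists f.
  by exists (fun=> fun=> 0).
pose F O M := projT1 (cid (ex O M)).
have FP O M : projective M -> _ := projT2 (cid (ex O M)).
exists _, nat, q, (fun O M a n => complex.Re (F O M a (g n))),
  (fun O N b n => complex.Re (quantum_response (N b) (g n))); split.
- move=> O M pM; have [f0 f1 _] := FP O M pM; split.
  + by move=> o _ Y mY; exact: I.
  + by move=> o n; exact: Re_ge0 (f0 _ _).
  + move=> n; apply: (@complexI R); rewrite rmorph_sum rmorph1 -(f1 (g n)).
    by apply: eq_bigr => o _; exact: ge0_ReK (f0 _ _).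
- move=> O N pN; split.
  + by move=> o _ Y mY; exact: I.
  + by move=> o n; apply/Re_ge0/quantum_response_ge0/projective_psd.
  + move=> n; apply: (@complexI R).
    rewrite rmorph_sum rmorph1 -(quantum_response_sum (g n) pN).
    by apply: eq_bigr => o _; apply/ge0_ReK/quantum_response_ge0/projective_psd.
move=> OA OB M N pM pN a b; have [f0 _ fE] := FP OA M pM.
rewrite -fE -(qE (fun h => complex.Re (F OA M a h)
   * complex.Re (quantum_response (N b) h))); last first.
  move=> h; rewrite mulr_ge0 ?(Re_ge0 (f0 _ _)) // Re_ge0 //.
  by apply/quantum_response_ge0/projective_psd.
apply: eq_bigr => h _; rewrite rmorphM /= (ge0_ReK (f0 _ _)) ge0_ReK //.
by apply/quantum_response_ge0/projective_psd.
Qed.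

End LocalModel.

(** * Joint measurements *)

(** Commutativity is not assumed because the factors will be matrices. *)
Lemma sum_prod_dffun (K : pzRingType) (I : finType) (T : I -> finType)
    (F : forall i, T i -> K) :
  \sum_(m : {dffun forall i, T i}) \prod_i F i (m i) = \prod_i \sum_t F i t.
Proof.
rewrite (reindex (@dffun_of_fprod I T)) /=; last first.
  exact/onW_bij/dffun_of_fprod_bij.
transitivity (\sum_(m : fprod T) \prod_i [ffun t => F i t] (m i)).
  by apply: eq_bigr => m _; apply: eq_bigr => i _; rewrite !ffunE.
rewrite (@big_fprod K 0 1 *%R +%R I T (fun i => [ffun t => F i t])).
rewrite -(bigA_distr_big_dep (fun i => mem (tagged_with T i))
  (fun i => untag 0 [ffun t => F i t])) /=.
apply: eq_bigr => i _; transitivity (\sum_t [ffun t => F i t] t).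
  by symmetry; exact: (big_tag (fun i => [ffun t => F i t] : T i -> K) i).
by apply: eq_bigr => t _; rewrite ffunE.
Qed.

Section CommutingProduct.
Variables (K : pzRingType) (I : eqType) (T : I -> eqType).
Variable F : forall i, T i -> K.
Hypothesis F_comm : forall i j a b, GRing.comm (F (i := i) a) (F (i := j) b).
Hypothesis F_orth : forall i a b,
  F (i := i) a * F b = if a == b then F a else 0.

Lemma comm_prod_seq (r : seq I) (m : forall i, T i) i a :
  GRing.comm (F (i := i) a) (\prod_(j <- r) F (m j)).
Proof. by apply: commr_prod => j _; apply: F_comm. Qed.

Lemma prod_seq_orth (r : seq I) (m m' : forall i, T i) :
  (\prod_(j <- r) F (m j)) * (\prod_(j <- r) F (m' j)) =
  if all (fun j => m j == m' j) r then \prod_(j <- r) F (m j) else 0.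
Proof.
elim: r => [|j r IH]; first by rewrite !big_nil mulr1.
rewrite !big_cons /= -mulrA (mulrA (\prod_(_ <- _) _)).
rewrite -(comm_prod_seq r m (m' j)) -mulrA mulrA F_orth IH.
by case: eqP; case: (all _ _) => //=; rewrite ?mulr0 ?mul0r.
Qed.

End CommutingProduct.

Section JointProjective.
Variable R : realType.
Local Notation C := R[i].

(** A context acts as one projective measurement with joint outcomes, so a local model directly
    supplies the block responses of a GLHV model. Commutation enters both in self-adjointness and in
    orthogonality. *)
Lemma joint_projective d (X : party) (M : assignment R d X) K :
  compatible_projective M -> contexts X K ->
  projective (fun m : joint K => joint_proj M m).
Proof.
move=> cM KX; have [pM cMK] := cM K KX.
pose F (j : K) (a : outcome (val j)) : 'M[C]_d := M (val j) a.
have Fc (i j : K) a b : GRing.comm (F i a) (F j b).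
  by apply: cMK; exact: valP.
have pF (j : K) : projective (F j) by apply: pM; exact: valP.
have Fo (j : K) a b : F j a * F j b = if a == b then F j a else 0.
  by have [_ o _] := pF j; exact: o.
split.
- move=> m; apply/hermsymmxP; rewrite /joint_proj.
  elim: (index_enum _) => [|j r IH].
    by rewrite !big_nil trmx1 map_mx1.
  rewrite !big_cons trmx_mul map_mxM /= -IH.
  have [h _ _] := pF j.
  have /hermsymmxP <- := h (m j).
  exact: (comm_prod_seq Fc r m (m j)).
- move=> m m'; transitivity (if all (fun j => m j == m' j) (index_enum K)
     then joint_proj M m else 0).
    exact: (prod_seq_orth Fc Fo).
  congr (if _ then _ else _); apply/allP/eqP => [H|-> //].
  by apply/ffunP => j; apply/eqP/H/mem_index_enum.
- transitivity (\prod_(j : K) \sum_a F j a).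
    by rewrite -sum_prod_dffun.
  by apply: big1 => j _; have [_ _ ->] := pF j.
Qed.

Lemma local_projective_GLHV d (rho : 'M[C]_(d * d)) (S : scenario)
    (M : assignment R d (alice S)) (N : assignment R d (bob S)) :
  local_projective rho -> compatible_projective M -> compatible_projective N ->
  GLHV (born M N rho).
Proof.
move=> [disp [L [q [pA [pB [rA rB E]]]]]] cM cN.
exists disp, L, q, (fun K => pA (joint K) (fun m => joint_proj M m)),
  (fun K => pB (joint K) (fun m => joint_proj N m)); split.
- by move=> K KX; apply/rA/joint_projective.
- by move=> K KX; apply/rB/joint_projective.
move=> KA KB /(@tested_sub S)[/= hA hB] mA mB.
by apply: E; apply: joint_projective.
Qed.

End JointProjective.

(** * Partial transpose *)

Section TensorLinear.
Variable K : comPzRingType.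

Lemma tensmx_suml m n p q (I : finType) (A : I -> 'M[K]_(m, n)) (B : 'M[K]_(p, q)) :
  (\sum_i A i) *t B = \sum_i A i *t B.
Proof.
apply/matrixP => i j; rewrite mxE !summxE mulr_suml.
by apply: eq_bigr => k _; rewrite mxE.
Qed.

Lemma tensmx_sumr m n p q (I : finType) (A : 'M[K]_(m, n)) (B : I -> 'M[K]_(p, q)) :
  A *t (\sum_i B i) = \sum_i A *t B i.
Proof.
apply/matrixP => i j; rewrite mxE !summxE mulr_sumr.
by apply: eq_bigr => k _; rewrite mxE.
Qed.

Lemma sum_delta_mx n : \sum_i (delta_mx i i : 'M[K]_n) = 1%:M.
Proof. by rewrite -diag_const_mx diag_mx_sum_delta; apply: eq_bigr => i _; rewrite mxE scale1r. Qed.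

End TensorLinear.

Section Entanglement.
Variable R : realType.
Local Notation C := R[i].

Lemma psdD d (A B : 'M[C]_d) : psd A -> psd B -> psd (A + B).
Proof. by move=> pA pB u; rewrite mulmxDr mulmxDl mxE addr_ge0. Qed.

Lemma psdZ d (a : C) (A : 'M[C]_d) : 0 <= a -> psd A -> psd (a *: A).
Proof. by move=> a0 pA u; rewrite -scalemxAr -scalemxAl mxE mulr_ge0. Qed.

Lemma hermD d (A B : 'M[C]_d) :
  A \is hermsymmx -> B \is hermsymmx -> A + B \is hermsymmx.
Proof.
move=> /hermsymmxP hA /hermsymmxP hB; apply/hermsymmxP.
by rewrite linearD map_mxD -hA -hB.
Qed.

Lemma hermZ d (a : C) (A : 'M[C]_d) :
  (a^*)%R = a -> A \is hermsymmx -> a *: A \is hermsymmx.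
Proof.
move=> ha /hermsymmxP hA; apply/hermsymmxP.
by rewrite linearZ map_mxZ -hA /= ha.
Qed.

Lemma herm1 d : (1%:M : 'M[C]_d) \is hermsymmx.
Proof. by apply/hermsymmxP; rewrite trmx1 map_mx1. Qed.

Lemma adj_tens m n p q (A : 'M[C]_(m, n)) (B : 'M[C]_(p, q)) :
  (A *t B)^t* = A^t* *t B^t*.
Proof. by rewrite trmx_tens map_mxT. Qed.

Lemma adj_delta m n (i : 'I_m) (j : 'I_n) :
  (delta_mx i j : 'M[C]_(m, n))^t* = delta_mx j i.
Proof. by rewrite trmx_delta map_delta_mx. Qed.

Lemma herm_tens m n (A : 'M[C]_m) (B : 'M[C]_n) :
  A \is hermsymmx -> B \is hermsymmx -> A *t B \is hermsymmx.
Proof.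
by move=> /hermsymmxP hA /hermsymmxP hB; apply/hermsymmxP; rewrite adj_tens -hA -hB.
Qed.

Lemma swap_op_herm d : swap_op R d \is hermsymmx.
Proof.
apply/hermsymmxP; rewrite {1}/swap_op exchange_big /= /swap_op !raddf_sum /=.
apply: eq_bigr => i _; rewrite !raddf_sum /=; apply: eq_bigr => j _.
by rewrite adj_tens !adj_delta.
Qed.

Lemma swap_op_sqr d : swap_op R d *m swap_op R d = 1%:M.
Proof.
rewrite -tens1mx1 -!sum_delta_mx tensmx_suml {1}/swap_op mulmx_suml.
apply: eq_bigr => i _; rewrite mulmx_suml tensmx_sumr; apply: eq_bigr => j _.
rewrite /swap_op mulmx_sumr (bigD1 j) //= [X in _ + X]big1 ?addr0 => [|k kj].
  rewrite mulmx_sumr (bigD1 i) //= [X in _ + X]big1 ?addr0 => [|l li].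
    by rewrite tensmx_mul !mul_delta_mx.
  by rewrite tensmx_mul [X in _ *t X]mul_delta_mx_0 ?tensmx0 // eq_sym.
rewrite mulmx_sumr big1 // => l _.
by rewrite tensmx_mul mul_delta_mx_0 ?tens0mx // eq_sym.
Qed.

Lemma P_anti_herm : P_anti R \is hermsymmx.
Proof.
apply: hermZ; first by rewrite fmorphV rmorph_nat.
apply: hermD (herm1 _) _; rewrite -scaleN1r; apply: hermZ (swap_op_herm _).
by rewrite rmorphN rmorph1.
Qed.

Lemma P_anti_sqr : P_anti R *m P_anti R = P_anti R.
Proof.
rewrite /P_anti -scalemxAl -scalemxAr mulmxBl !mulmxBr mul1mx mulmx1 swap_op_sqr.
rewrite mul1mx opprB addrA; move: (1%:M : 'M[C]_(3 * 3)) (swap_op R 3) => X V.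
by apply/matrixP => i j; rewrite !mxE; field.
Qed.

Lemma proj0_herm : proj0 R \is hermsymmx.
Proof. by apply/hermsymmxP; rewrite adj_delta. Qed.

Lemma proj0_sqr : proj0 R *m proj0 R = proj0 R.
Proof. by rewrite mul_delta_mx. Qed.

Lemma rho_AB_density : density (rho_AB R).
Proof.
have inv0 n : 0 <= (n%:R^-1 : C) by rewrite invr_ge0 ler0n.
have invC n : ((n%:R^-1 : C)^*)%R = n%:R^-1 by rewrite fmorphV rmorph_nat.
split.
- rewrite /rho_AB /rho_W; apply: hermD; apply: hermZ (invC _) _.
    exact: herm_tens proj0_herm proj0_herm.
  apply: hermD; apply: hermZ (invC _) _; apply: hermZ (invC _) _.
    exact: P_anti_herm.
  exact: herm1.
- rewrite /rho_AB /rho_W; apply: psdD; apply: psdZ (inv0 _) _.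
    apply: projector_psd; first exact: herm_tens proj0_herm proj0_herm.
    by rewrite tensmx_mul proj0_sqr.
  apply: psdD; apply: psdZ (inv0 _) _; apply: psdZ (inv0 _) _.
    exact: projector_psd P_anti_herm P_anti_sqr.
  by apply: projector_psd (herm1 _) _; rewrite mulmx1.
- have := tr_rho_AB (1%:M : 'M[C]_3) 1%:M.
  rewrite tens1mx1 !mulmx1 => ->.
  by rewrite mxtrace1 mxE eqxx mulr1n; field.
Qed.

(** Gram factorizations make positivity visibly stable under tensor products and transposition. *)
Lemma psd_factor d (A : 'M[C]_d) : A \is hermsymmx -> psd A ->
  exists B : 'M[C]_d, A = B^t* *m B.
Proof.
move=> hA pA; have /orthomx_spectralP := hermitian_normalmx hA.
set P := spectralmx A; set D := spectral_diag A.
have Pu : P \is unitarymx by apply: spectral_unitarymx.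
have PP : P *m P^t* = 1%:M by apply/unitarymxP.
rewrite invmx_unitary // => AE.
have D0 i : 0 <= D 0 i.
  have := pA (P^t* *m delta_mx i 0).
  rewrite trmx_mul map_mxM /= trmxCK adj_delta AE !mulmxA -!mulmxA.
  rewrite (mulmxA P (P^t*)) PP mul1mx (mulmxA P (P^t*)) PP mul1mx.
  by rewrite -rowE -colE !mxE eqxx mulr1n.
exists (diag_mx (map_mx sqrtC D) *m P).
set S := diag_mx _; have SS : S^t* *m S = diag_mx D.
  rewrite tr_diag_mx map_diag_mx mulmx_diag; congr diag_mx.
  apply/rowP => i; rewrite !mxE.
  by rewrite mulrC -normCK ger0_norm ?sqrtC_ge0 // sqrtCK.
by rewrite trmx_mul map_mxM /= mulmxA -(mulmxA (P^t*)) SS.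
Qed.

Lemma psd_tens m n (A : 'M[C]_m) (B : 'M[C]_n) :
  A \is hermsymmx -> psd A -> B \is hermsymmx -> psd B -> psd (A *t B).
Proof.
move=> /psd_factor hA /hA[A' ->] /psd_factor hB /hB[B' ->].
by rewrite -tensmx_mul -adj_tens; apply: gram_psd.
Qed.

Lemma herm_tr d (A : 'M[C]_d) : A \is hermsymmx -> A^T \is hermsymmx.
Proof. by move=> /hermsymmxP hA; apply/hermsymmxP; rewrite [in LHS]hA map_trmx. Qed.

Lemma psd_tr d (A : 'M[C]_d) : A \is hermsymmx -> psd A -> psd A^T.
Proof.
move=> /psd_factor hA /hA[B ->].
have -> : (B^t* *m B)^T = (map_mx Num.conj B)^t* *m map_mx Num.conj B.
  by rewrite trmx_mul; congr (_ *m _); apply/matrixP => i j; rewrite !mxE ?conjCK.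
exact: gram_psd.
Qed.

Lemma ptranspose_tens dA dB (A : 'M[C]_dA) (B : 'M[C]_dB) :
  ptranspose (A *t B) = A *t B^T.
Proof.
by apply/matrixP => x y; rewrite mxE tensmxE !mxE.
Qed.

Lemma ptransposeD dA dB (A B : 'M[C]_(dA * dB)) :
  ptranspose (A + B) = ptranspose A + ptranspose B.
Proof. by apply/matrixP => x y; rewrite !mxE. Qed.

Lemma ptransposeZ dA dB a (A : 'M[C]_(dA * dB)) :
  ptranspose (a *: A) = a *: ptranspose A.
Proof. by apply/matrixP => x y; rewrite !mxE. Qed.

Lemma ptranspose_sum dA dB (I : finType) (A : I -> 'M[C]_(dA * dB)) :
  ptranspose (\sum_i A i) = \sum_i ptranspose (A i).
Proof.
apply: (big_morph _ (@ptransposeD dA dB)).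
by apply/matrixP => x y; rewrite !mxE.
Qed.

Lemma separable_ptranspose_psd dA dB (rho : 'M[C]_(dA * dB)) :
  separable rho -> psd (ptranspose rho).
Proof.
move=> [n [w [s [t [w0 _ st ->]]]]] u; rewrite ptranspose_sum.
rewrite mulmx_sumr mulmx_suml summxE; apply: sumr_ge0 => k _.
have [[hs ps _] [ht pt _]] := st k.
rewrite ptransposeZ ptranspose_tens; apply: psdZ; first by rewrite lecR.
by apply: psd_tens; rewrite ?herm_tr //; apply: psd_tr.
Qed.

Definition ptval : R := (37 - 3 * Num.sqrt 177) / 144.

Lemma ptval_lt0 : ptval < 0.
Proof.
have s0 : 0 <= Num.sqrt 177 :> R by apply: sqrtr_ge0.
have s2 : Num.sqrt 177 ^+ 2 = 177 :> R by rewrite sqr_sqrtr.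
rewrite /ptval; have : 13 < Num.sqrt 177 :> R.
  by rewrite -(@ltr_pXn2r _ 2) ?nnegrE // s2; lra.
lra.
Qed.

Definition diag_ket (i : 'I_3) : 'M[C]_(1 * 1, 3 * 3) :=
  (delta_mx 0 i : 'M[C]_(1, 3)) *t (delta_mx 0 i : 'M[C]_(1, 3)).

(** Partial transposition turns [V] into the unnormalized projector onto [|00> + |11> + |22>], so
    the span of [|00>] and [|11> + |22>] is stable. On it [ptranspose (rho_AB R)] has trace 37/72
    and determinant -7/648, and this vector belongs to the negative root. It is a row because
    [eigenvalue] acts on rows. *)
Definition pt_eigenvector : 'M[C]_(1 * 1, 3 * 3) :=
  ((Num.sqrt 177)%:C - 13) *: diag_ket 0
  + 2 *: (diag_ket 1 + diag_ket (1 + 1)).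

Lemma ptranspose_rho_AB : ptranspose (rho_AB R) =
  2^-1 *: (proj0 R *t proj0 R) + (5 / 72) *: 1%:M
  - 24^-1 *: \sum_i \sum_j (delta_mx i j *t delta_mx i j).
Proof.
rewrite rho_ABE -scaleNr !ptransposeD !ptransposeZ scaleNr.
rewrite -{1}tens1mx1 !ptranspose_tens trmx1 trmx_delta tens1mx1.
congr (_ - _ *: _); rewrite ptranspose_sum; apply: eq_bigr => i _.
rewrite ptranspose_sum; apply: eq_bigr => j _.
by rewrite ptranspose_tens trmx_delta.
Qed.

Lemma diag_ket_flip i :
  diag_ket i *m (\sum_i \sum_j ((delta_mx i j : 'M[C]_3) *t (delta_mx i j : 'M[C]_3)))
  = diag_ket 0 + diag_ket 1 + diag_ket (1 + 1).
Proof.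
rewrite mulmx_sumr (bigD1 i) //= [X in _ + X]big1 ?addr0 => [|k ki].
  rewrite mulmx_sumr big_ord3.
  by rewrite /diag_ket !tensmx_mul !mul_delta_mx.
rewrite mulmx_sumr big1 // => j _.
by rewrite /diag_ket tensmx_mul mul_delta_mx_0 ?tens0mx // eq_sym.
Qed.

Lemma diag_ket_proj0 i : diag_ket i *m (proj0 R *t proj0 R) =
  (i == 0)%:R *: diag_ket 0.
Proof.
rewrite /diag_ket tensmx_mul; case: eqVneq => [->|i0].
  by rewrite !mul_delta_mx scale1r.
by rewrite mul_delta_mx_0 // tens0mx scale0r.
Qed.

Lemma pt_eigenvectorP :
  pt_eigenvector *m ptranspose (rho_AB R) = ptval%:C *: pt_eigenvector.
Proof.
have s2 : (Num.sqrt 177)%:C ^+ 2 = 177 :> C.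
  by rewrite -rmorphXn /= sqr_sqrtr // rmorph_nat.
have -> : ptval%:C = (37 - 3 * (Num.sqrt 177)%:C) / 144 :> C.
  by rewrite /ptval rmorphM rmorphB rmorphM fmorphV !rmorph_nat.
rewrite ptranspose_rho_AB /pt_eigenvector.
move: (Num.sqrt 177)%:C s2 => s s2.
rewrite mulmxDl -!scalemxAl mulmxDl !mulmxBr !mulmxDr -!scalemxAr !mulmx1.
have e1 : (1 == 0 :> 'I_3) = false by [].
have e2 : (1 + 1 == 0 :> 'I_3) = false by [].
rewrite !diag_ket_flip !diag_ket_proj0 eqxx e1 e2 scale1r !scale0r.
move: (diag_ket 0) (diag_ket 1) (diag_ket (1 + 1)) => f0 f1 f2.
apply/matrixP => i j; rewrite !mxE.
move: (f0 i j) (f1 i j) (f2 i j) => a b c.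
apply/eqP; rewrite -subr_eq0.
set e := (X in X == 0).
(* The two sides differ only in the coefficient of [|00>], by a multiple of the equation of
   [Num.sqrt 177]. *)
have -> : e = (s ^+ 2 - 177) / 48 * a by rewrite /e; field.
by rewrite s2 subrr !mul0r.
Qed.

Lemma pt_eigenvector_neq0 : pt_eigenvector != 0.
Proof.
apply/eqP => /matrixP/(_ (mxtens_index (0, 0)) (mxtens_index (1, 1)))/eqP.
rewrite !mxE !mxtens_indexK /=.
by rewrite !mulr0 !mulr1 add0r addr0 mulr1 pnatr_eq0.
Qed.

Lemma ptranspose_eigenvalue : eigenvalue (ptranspose (rho_AB R)) ptval%:C.
Proof.
apply/eigenvalueP; exists (pt_eigenvector : 'rV_(3 * 3)).
  exact: pt_eigenvectorP.
exact: pt_eigenvector_neq0.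
Qed.

Lemma rho_AB_entangled : entangled (rho_AB R).
Proof.
split; first exact: rho_AB_density.
move=> /separable_ptranspose_psd /(_ ((pt_eigenvector : 'rV_(3 * 3))^t*)).
rewrite trmxCK pt_eigenvectorP -scalemxAl mxE.
have v0 : (pt_eigenvector : 'rV_(3 * 3))^t* != 0.
  apply: contra pt_eigenvector_neq0 => /eqP /(congr1 (fun A => A^t*)).
  by rewrite trmxCK trmx0 map_mx0 => ->.
have := nsq_gt0 v0; rewrite /nsq trmxCK => n0.
rewrite pmulr_lge0 // lecR leNgt ptval_lt0 //.
Qed.

End Entanglement.

(** * The KCBS observables *)

Section Reduced.
Variable R : realType.
Local Notation C := R[i].

(** The marginals and the conditional state, normalized or not, all have this form, which is
    invariant under rotations about the axis [|0>] of the pentagon. *)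
Definition loc_state (a b : C) : 'M[C]_3 :=
  a *: delta_mx 0 0 + b *: delta_mx 1 1 + b *: delta_mx 2 2.

Lemma one_delta3 : (1%:M : 'M[C]_3) = delta_mx 0 0 + delta_mx 1 1 + delta_mx 2 2.
Proof. by rewrite -sum_delta_mx big_ord3; congr (_ + _ + delta_mx _ _); apply: val_inj. Qed.

Lemma mxtraceB n (A B : 'M[C]_n) : \tr (A - B) = \tr A - \tr B.
Proof. exact: raddfB. Qed.

Lemma adjD m n (A B : 'M[C]_(m, n)) : (A + B)^t* = A^t* + B^t*.
Proof. by apply/matrixP => i j; rewrite !mxE rmorphD. Qed.

Lemma redAD dA dB (A B : 'M[C]_(dA * dB)) : redA (A + B) = redA A + redA B.
Proof.
apply/matrixP => i j; rewrite !mxE -big_split.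
by apply: eq_bigr => k _; rewrite mxE.
Qed.

Lemma redAZ dA dB a (A : 'M[C]_(dA * dB)) : redA (a *: A) = a *: redA A.
Proof.
apply/matrixP => i j; rewrite !mxE mulr_sumr.
by apply: eq_bigr => k _; rewrite mxE.
Qed.

Lemma redBD dA dB (A B : 'M[C]_(dA * dB)) : redB (A + B) = redB A + redB B.
Proof.
apply/matrixP => i j; rewrite !mxE -big_split.
by apply: eq_bigr => k _; rewrite mxE.
Qed.

Lemma redBZ dA dB a (A : 'M[C]_(dA * dB)) : redB (a *: A) = a *: redB A.
Proof.
apply/matrixP => i j; rewrite !mxE mulr_sumr.
by apply: eq_bigr => k _; rewrite mxE.
Qed.

Lemma redA_sum dA dB (I : finType) (A : I -> 'M[C]_(dA * dB)) :
  redA (\sum_i A i) = \sum_i redA (A i).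
Proof.
apply: (big_morph _ (@redAD dA dB)).
by apply/matrixP => x y; rewrite !mxE big1 // => k _; rewrite mxE.
Qed.

Lemma redB_sum dA dB (I : finType) (A : I -> 'M[C]_(dA * dB)) :
  redB (\sum_i A i) = \sum_i redB (A i).
Proof.
apply: (big_morph _ (@redBD dA dB)).
by apply/matrixP => x y; rewrite !mxE big1 // => k _; rewrite mxE.
Qed.

Lemma redA_tens dA dB (A : 'M[C]_dA) (B : 'M[C]_dB) : redA (A *t B) = \tr B *: A.
Proof.
apply/matrixP => i j; rewrite !mxE mulr_suml.
by apply: eq_bigr => k _; rewrite tensmxE mulrC.
Qed.

Lemma redB_tens dA dB (A : 'M[C]_dA) (B : 'M[C]_dB) : redB (A *t B) = \tr A *: B.
Proof.
apply/matrixP => i j; rewrite !mxE mulr_suml.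
by apply: eq_bigr => k _; rewrite tensmxE.
Qed.

Lemma tr_delta n (i j : 'I_n) : \tr (delta_mx i j : 'M[C]_n) = (i == j)%:R.
Proof. by rewrite -[delta_mx i j]mulmx1 tr_mul_delta mxE eq_sym. Qed.

Lemma redA_swap d : redA (swap_op R d) = 1%:M.
Proof.
rewrite redA_sum -sum_delta_mx; apply: eq_bigr => i _.
rewrite redA_sum (bigD1 i) //= [X in _ + X]big1 ?addr0 => [|j ji];
  rewrite redA_tens tr_delta ?eqxx ?scale1r //.
by rewrite (negPf ji) scale0r.
Qed.

Lemma redB_swap d : redB (swap_op R d) = 1%:M.
Proof.
rewrite /swap_op exchange_big redB_sum -sum_delta_mx; apply: eq_bigr => i _.
rewrite redB_sum (bigD1 i) //= [X in _ + X]big1 ?addr0 => [|j ji];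
  rewrite redB_tens tr_delta ?eqxx ?scale1r //.
by rewrite (negPf ji) scale0r.
Qed.

Lemma redA_rho_AB : redA (rho_AB R) = loc_state (2 / 3) 6^-1.
Proof.
rewrite rho_ABE -scaleNr !redAD !redAZ redA_swap -tens1mx1 !redA_tens tr_delta.
rewrite mxtrace1 scale1r one_delta3 /loc_state /proj0.
move: (delta_mx 0 0) (delta_mx 1 1) (delta_mx 2 2) => X Y Z.
by apply/matrixP => i j; rewrite !mxE; field.
Qed.

Lemma redB_rho_AB : redB (rho_AB R) = loc_state (2 / 3) 6^-1.
Proof.
rewrite rho_ABE -scaleNr !redBD !redBZ redB_swap -tens1mx1 !redB_tens tr_delta.
rewrite mxtrace1 scale1r one_delta3 /loc_state /proj0.
move: (delta_mx 0 0) (delta_mx 1 1) (delta_mx 2 2) => X Y Z.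
by apply/matrixP => i j; rewrite !mxE; field.
Qed.

Lemma probA_rho_AB : probA (rho_AB R) (proj0 R) = 2 / 3.
Proof.
rewrite /probA tr_rho_AB mulmx1 tr_delta mxtrace1 !mxE /=.
by rewrite !mulr1n; field.
Qed.

Lemma condB_rho_AB : condB (rho_AB R) (proj0 R) = loc_state (19 / 24) (5 / 48).
Proof.
rewrite /condB probA_rho_AB rho_ABE.
rewrite mulmxBr mulmxDr mulmxBl mulmxDl -!scalemxAr -!scalemxAl mulmx1.
rewrite -scaleNr !redBD !redBZ.
have -> : proj0 R *t 1%:M *m swap_op R 3 *m (proj0 R *t 1%:M) =
    proj0 R *t proj0 R.
  rewrite /swap_op mulmx_sumr mulmx_suml (bigD1 0) //= [X in _ + X]big1.
    rewrite addr0 mulmx_sumr mulmx_suml (bigD1 0) //= [X in _ + X]big1.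
      by rewrite addr0 !tensmx_mul mul1mx mulmx1 !mul_delta_mx.
    move=> j j0; rewrite !tensmx_mul [X in X *t _](_ : _ = 0) ?tens0mx //.
    by rewrite mul_delta_mx mul_delta_mx_0.
  move=> i i0; rewrite mulmx_sumr mulmx_suml big1 // => j _.
  rewrite !tensmx_mul [X in X *t _](_ : _ = 0) ?tens0mx //.
  by rewrite mul_delta_mx_0 ?mul0mx // eq_sym.
rewrite !tensmx_mul !mulmx1 !mul1mx !mul_delta_mx !redB_tens tr_delta.
rewrite one_delta3 /loc_state /proj0 /= scale1r.
move: (delta_mx 0 0) (delta_mx 1 1) (delta_mx 2 2) => X Y Z.
by apply/matrixP => i j; rewrite !mxE; field.
Qed.

End Reduced.

(** * The pentagon of KCBS vectors *)

Section KCBS.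
Variable R : realType.
Local Notation C := R[i].
Variable theta : R.
Hypothesis cos_sqr : cos theta ^+ 2 = (Num.sqrt 5)^-1.

Lemma sqrt5_sqr : Num.sqrt 5 ^+ 2 = 5 :> R.
Proof. by rewrite sqr_sqrtr. Qed.

Lemma sqrt5_gt0 : 0 < Num.sqrt 5 :> R.
Proof. by rewrite sqrtr_gt0. Qed.

(** For [c = cos (pi / 5)], the relation [cos 3a = - cos 2a] reads [(c + 1) (4 c^2 - 2 c - 1) = 0],
    and [c > 0] selects [c = (1 + sqrt 5) / 4]. *)
Lemma cos_4pi5 : cos (4 * pi / 5) = - (1 + Num.sqrt 5) / 4 :> R.
Proof.
have p0 : 0 < pi :> R := pi_gt0 R.
set a : R := pi / 5.
have c0 : 0 < cos a.
  by apply: cos_gt0_pihalf; rewrite /a; apply/andP; split; lra.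
have e : cos (a + (a + a)) = - cos (a + a).
  have -> : a + (a + a) = - (a + a) + pi by rewrite /a; field.
  by rewrite cosDpi cosN.
move: e; rewrite cosD !cosD sinD.
have s2 : sin a ^+ 2 = 1 - cos a ^+ 2 by rewrite -(cos2Dsin2 a); ring.
have -> : 4 * pi / 5 = - a + pi by rewrite /a; field.
rewrite cosDpi cosN => e.
have f : (cos a + 1) * ((4 * cos a - 1) ^+ 2 - 5) = 0.
  have := s2; move: (cos a) (sin a) e => c s e s2'.
  have : c * (c * c - s ^+ 2) - (2 * c * s ^+ 2) = - (c * c - s ^+ 2).
    by rewrite -[LHS]/(_ - _); lra.
  rewrite s2' => g; lra.
have : (4 * cos a - 1) ^+ 2 = 5.
  by move/eqP: f; rewrite mulf_eq0 subr_eq0 => /orP[/eqP|/eqP //]; lra.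
rewrite -[X in _ = X -> _]sqrt5_sqr => /eqP; rewrite eqf_sqr => /orP[] /eqP h.
  lra.
move: h; have := sqrt5_sqr; have := sqrt5_gt0; move: (Num.sqrt 5 : R) (cos a) c0 => s c c0 s0 s2' h.
have : s < 1 by lra.
nra.
Qed.

Let phi (j : 'Z_5) : R := 4 * pi * (j : nat)%:R / 5.

Lemma cos_phi_step j : cos (phi (j + 1)) * cos (phi j) + sin (phi (j + 1)) * sin (phi j)
  = - (1 + Num.sqrt 5) / 4.
Proof.
rewrite -cosB -cos_4pi5 /phi.
have -> : (j + 1)%R = nth 0%N [:: 1; 2; 3; 4; 0]%N j :> nat.
  by case: j => -[|[|[|[|[|m]]]]] h.
case: j => -[|[|[|[|[|m]]]]] h //=; try by congr cos; field.
(* Going from vertex 4 to vertex 0 changes the angle by -16 pi / 5, which is 4 pi / 5 up to two full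
   turns. *)
rewrite -[LHS]cosD2pi -[LHS]cosD2pi; congr cos.
by rewrite -(mulr_natr pi); field.
Qed.

Local Notation v := (kcbs_vec theta).

Definition kcbs_rank1 (j : 'Z_5) : 'M[C]_3 := v j *m (v j)^t*.

Lemma kcbs_vec_row j : (v j)^t* = (cos theta)%:C *: delta_mx 0 0
  + (sin theta * cos (phi j))%:C *: delta_mx 0 1
  + (sin theta * sin (phi j))%:C *: delta_mx 0 2 :> 'M[C]_(1, 3).
Proof.
have adj (x : R) (i : 'I_3) (k : 'I_1) :
    (x%:C *: (delta_mx i k : 'M[C]_(3, 1)))^t* = x%:C *: delta_mx k i.
  rewrite linearZ /= map_mxZ adj_delta; congr (_ *: _).
  by apply/CrealP; rewrite complex_real.
rewrite /kcbs_vec -/(phi j).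
move: (cos theta) (sin theta * cos _) (sin theta * sin _) => x y z.
by rewrite adjD (adjD (_ *: _)); congr (_ + _ + _); apply: adj.
Qed.

Lemma kcbs_vec_dot j k : (v j)^t* *m v k =
  (cos theta ^+ 2 + sin theta ^+ 2 * (cos (phi j) * cos (phi k)
     + sin (phi j) * sin (phi k)))%:C%:M.
Proof.
rewrite kcbs_vec_row /kcbs_vec -/(phi k).
have dd (x y z x' y' z' : C) :
    (x *: delta_mx 0 0 + y *: delta_mx 0 1 + z *: delta_mx 0 2 : 'M[C]_(1, 3)) *m
    (x' *: delta_mx 0 0 + y' *: delta_mx 1 0 + z' *: delta_mx 2 0 : 'M[C]_(3, 1))
    = (x * x' + y * y' + z * z')%:M.
  apply/matrixP => i i'; rewrite !ord1 mxE big_ord3 !mxE /=.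
  by rewrite !(mulr1n, mulr0n, mulr1, mulr0, addr0, add0r).
rewrite dd -!rmorphM -!rmorphD; congr (_%:C%:M); ring.
Qed.

Lemma sin_sqr : sin theta ^+ 2 = 1 - (Num.sqrt 5)^-1.
Proof. by rewrite -cos_sqr -(cos2Dsin2 theta); ring. Qed.

(** The value [1 / sqrt 5] of [cos theta ^+ 2] is the solution of
    [cos^2 + sin^2 * cos (4 pi / 5) = 0]. *)
Lemma kcbs_orthS j : (v (j + 1))^t* *m v j = 0.
Proof.
rewrite kcbs_vec_dot cos_phi_step cos_sqr sin_sqr.
have s0 := lt0r_neq0 sqrt5_gt0.
rewrite (_ : _ + _ = 0) ?scalemx0 ?raddf0 //.
have e1 : (Num.sqrt 5)^-1 * Num.sqrt 5 = 1 :> R by rewrite mulVf.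
have e2 : 5 * (Num.sqrt 5)^-1 = Num.sqrt 5 :> R.
  by rewrite -[X in X * _]sqrt5_sqr expr2 -mulrA [_ / _]mulrC e1 mulr1.
move: (Num.sqrt 5 : R) (Num.sqrt 5)^-1 e1 e2 => s t e1 e2.
transitivity ((5 * t - s) / 4 + (t * s - 1) / 4); first by field.
by rewrite e1 e2 !subrr !mul0r addr0.
Qed.

Lemma kcbs_orth j : (v j)^t* *m v (j + 1) = 0.
Proof.
by rewrite -[LHS]trmxCK trmx_mul map_mxM /= trmxCK kcbs_orthS trmx0 map_mx0.
Qed.

Lemma kcbs_rank1_orth j : kcbs_rank1 j *m kcbs_rank1 (j + 1) = 0.
Proof. by rewrite /kcbs_rank1 mulmxA -(mulmxA (v j)) kcbs_orth mulmx0 mul0mx. Qed.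

Lemma kcbs_rank1_orthS j : kcbs_rank1 (j + 1) *m kcbs_rank1 j = 0.
Proof.
by rewrite /kcbs_rank1 mulmxA -(mulmxA (v (j + 1))) kcbs_orthS mulmx0 mul0mx.
Qed.

Lemma kcbs_obsE j : kcbs_obs theta j = 1%:M - 2 *: kcbs_rank1 j.
Proof. by []. Qed.

Lemma kcbs_projE j (b : bool) : @kcbs_proj R theta j b =
  if b then kcbs_rank1 j else 1%:M - kcbs_rank1 j.
Proof.
rewrite /kcbs_proj kcbs_obsE; move: (kcbs_rank1 j) (1%:M : 'M[C]_3) => P I.
by case: b; apply/matrixP => i k; rewrite !mxE /=; field.
Qed.

(** The weight of the outcome -1 of [B_j] in [loc_state a b], the same for all [j] by rotational
    symmetry. *)
Definition kcbs_prob (a b : C) : C :=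
  a * (Num.sqrt 5)^-1%:C + b * (1 - (Num.sqrt 5)^-1)%:C.

Lemma tr_loc_state (a b : C) (A : 'M[C]_3) :
  \tr (loc_state a b *m A) = a * A 0 0 + b * A 1 1 + b * A 2 2.
Proof.
by rewrite /loc_state !mulmxDl !linearD /= -!scalemxAl !linearZ /= !tr_mul_delta.
Qed.

Lemma tr_loc_state1 (a b : C) : \tr (loc_state a b) = a + 2 * b.
Proof. by rewrite -[loc_state a b]mulmx1 tr_loc_state !mxE /= !mulr1n; ring. Qed.

Lemma tr_loc_rank1 (a b : C) j : \tr (loc_state a b *m kcbs_rank1 j) = kcbs_prob a b.
Proof.
have e (x y z : C) (A : 'M[C]_3) :
    A = (x *: delta_mx 0 0 + y *: delta_mx 1 0 + z *: delta_mx 2 0) *m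
        (x *: delta_mx 0 0 + y *: delta_mx 0 1 + z *: delta_mx 0 2 : 'M[C]_(1, 3)) ->
    [/\ A 0 0 = x * x, A 1 1 = y * y & A 2 2 = z * z].
  by move=> ->; split; rewrite mxE big_ord1 !mxE /=
    !(mulr1n, mulr0n, mulr1, mulr0, addr0, add0r).
have [e0 e1 e2] : [/\ kcbs_rank1 j 0 0 = (cos theta)%:C * (cos theta)%:C,
    kcbs_rank1 j 1 1 = (sin theta * cos (phi j))%:C * (sin theta * cos (phi j))%:C
  & kcbs_rank1 j 2 2 = (sin theta * sin (phi j))%:C * (sin theta * sin (phi j))%:C].
  by apply: e; rewrite /kcbs_rank1 kcbs_vec_row.
rewrite tr_loc_state e0 e1 e2.
rewrite /kcbs_prob -sin_sqr -cos_sqr -(mulr1 (sin theta ^+ 2)).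
rewrite -(cos2Dsin2 (phi j)).
move: (cos theta) (sin theta) (cos (phi j)) (sin (phi j)) => x y z t.
rewrite !(rmorphD, rmorphM, rmorphXn) /=.
have g (p q r s : C) : a * (p * p) + b * (q * r * (q * r)) + b * (q * s * (q * s))
  = a * (p * p) + b * (q * q * (r * r + s * s)) by ring.
exact: g.
Qed.

(** Orthogonality of neighbours gives [B_j B_(j+1) = 1 - 2 P_j - 2 P_(j+1)], so each of the five
    projectors enters with total factor -4. *)
Lemma tr_loc_kcbs_op (a b : C) :
  \tr (loc_state a b *m kcbs_op theta) = 5 * (a + 2 * b) - 20 * kcbs_prob a b.
Proof.
rewrite /kcbs_op mulmx_sumr raddf_sum /=.
transitivity (\sum_(j : 'Z_5) ((a + 2 * b) - 4 * kcbs_prob a b)); last first.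
  by rewrite sumr_const card_ord (_ : (Zp_trunc 5).+2 = 5%N) // -(mulr_natr (_ - _)); ring.
apply: eq_bigr => j _.
have -> : kcbs_obs theta j *m kcbs_obs theta (j + 1) =
    1%:M - 2 *: kcbs_rank1 (j + 1) - 2 *: kcbs_rank1 j.
  rewrite !kcbs_obsE mulmxBl mul1mx mulmxBr mulmx1 -scalemxAl -scalemxAr.
  by rewrite kcbs_rank1_orth !scaler0 subr0.
have tr2 (r P Q : 'M[C]_3) : \tr (r *m (1%:M - 2 *: P - 2 *: Q)) =
    \tr r - 2 * \tr (r *m P) - 2 * \tr (r *m Q).
  by rewrite !mulmxBr mulmx1 -!scalemxAr !mxtraceB !mxtraceZ.
have := tr_loc_rank1 a b; have := tr_loc_state1 a b.
move: (loc_state a b) (kcbs_prob a b) => r p e1 e2.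
have combine (t u u' : C) : u = p -> u' = p -> t - 2 * u - 2 * u' = t - 4 * p.
  by move=> -> ->; ring.
by rewrite tr2 e1; exact: combine (e2 (j + 1)) (e2 j).
Qed.

Lemma tr_loc_context (a b : C) j (s t : bool) :
  \tr (loc_state a b *m (@kcbs_proj R theta j s *m @kcbs_proj R theta (j + 1) t))
  = if s then (if t then 0 else kcbs_prob a b)
    else if t then kcbs_prob a b else a + 2 * b - 2 * kcbs_prob a b.
Proof.
have := tr_loc_rank1 a b; have := tr_loc_state1 a b.
move: (loc_state a b) (kcbs_prob a b) => r p e1 e2.
rewrite !kcbs_projE; case: s; case: t.
- by rewrite kcbs_rank1_orth mulmx0 linear0.
- by rewrite (mulmxBr (kcbs_rank1 j)) mulmx1 kcbs_rank1_orth subr0 e2.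
- by rewrite mulmxBl mul1mx kcbs_rank1_orth subr0 e2.
have -> : (1%:M - kcbs_rank1 j) *m (1%:M - kcbs_rank1 (j + 1)) =
    1%:M - kcbs_rank1 j - kcbs_rank1 (j + 1).
  rewrite mulmxBl mul1mx mulmxBr mulmx1 kcbs_rank1_orth subr0.
  exact: addrAC.
have combine (t u u' : C) : u = p -> u' = p -> t - u - u' = t - 2 * p.
  by move=> -> ->; ring.
rewrite !mulmxBr mulmx1 !mxtraceB e1.
exact: combine (e2 j) (e2 (j + 1)).
Qed.

Lemma kcbs_proj_comm j (s t : bool) :
  @kcbs_proj R theta (j + 1) t *m @kcbs_proj R theta j s
  = @kcbs_proj R theta j s *m @kcbs_proj R theta (j + 1) t.
Proof.
have comm (P Q : 'M[C]_3) : P *m Q = 0 -> Q *m P = 0 ->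
    (if t then Q else 1%:M - Q) *m (if s then P else 1%:M - P) =
    (if s then P else 1%:M - P) *m (if t then Q else 1%:M - Q).
  move=> PQ QP; case: s; case: t;
    rewrite !(mulmxBl, mulmxBr, mul1mx, mulmx1, PQ, QP, subr0) //.
  by rewrite addrAC.
rewrite 2!kcbs_projE.
exact: comm (kcbs_rank1_orth j) (kcbs_rank1_orthS j).
Qed.

End KCBS.

(** * Noncontextual models *)

Section Fset2.
Variables (T : choiceType) (x y : T).
Hypothesis xy : x != y.
Let K := [fset x; y]%fset.
Let a : K := [` fset21 x y]%fset.
Let b : K := [` fset22 x y]%fset.

(** The order in which a finite set is enumerated is left open, hence the two cases. *)
Lemma index_enum_fset2 : index_enum K = [:: a; b] \/ index_enum K = [:: b; a].
Proof.
have ab : a != b by rewrite -val_eqE.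
have cov (k : K) : (k == a) || (k == b).
  by have := fsvalP k; rewrite in_fset2 -!val_eqE.
have U := index_enum_uniq K.
have : size (index_enum K) = 2%N.
  have -> : size (index_enum K) = #|{: K}|.
    by rewrite cardE enumT /index_enum unlock.
  by rewrite -cardfE cardfs2 xy.
move: U; case: (index_enum K) => [//|u [//|v []]] //= U _.
have uv : u != v by move: U; rewrite inE andbT.
case/orP: (cov u) (uv) => /eqP ->; case/orP: (cov v) => /eqP ->;
  rewrite ?eqxx //; by [left | right].
Qed.

Lemma prod_fset2 (A : comPzSemiRingType) (F : K -> A) : \prod_(k : K) F k = F a * F b.
Proof.
by case: index_enum_fset2 => ->; rewrite big_cons big_seq1 // mulrC.
Qed.

End Fset2.

Lemma index_enum_fset1 (T : choiceType) (x : T) :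
  index_enum [fset x]%fset = [:: [` fset11 x]%fset].
Proof.
have cov (k : [fset x]%fset) : k = [` fset11 x]%fset.
  by apply/val_inj/eqP; have := fsvalP k; rewrite in_fset1.
have : size (index_enum [fset x]%fset) = 1%N.
  have -> : size (index_enum [fset x]%fset) = #|{: [fset x]%fset}|.
    by rewrite cardE enumT /index_enum unlock.
  by rewrite -cardfE cardfs1.
by case: (index_enum _) => [//|u []] // _; rewrite [u]cov.
Qed.

Lemma big_Z5 (V : nmodType) (F : 'Z_5 -> V) :
  \sum_j F j = F 0 + F 1 + F 2 + F 3 + F 4.
Proof.
rewrite !big_ord_recl big_ord0 addr0 !addrA.
by congr (F _ + F _ + F _ + F _ + F _); apply: val_inj.
Qed.

Section BoundedIntegrals.
Context (disp : measure_display) (L : measurableType disp) (R : realType).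
Variable q : probability L R.

Lemma unit_integrable (f : L -> R) : measurable_fun [set: L] f ->
  (forall l, 0 <= f l <= 1) -> q.-integrable [set: L] (EFin \o f).
Proof.
move=> mf f01; apply: measurable_bounded_integrable => //.
  by rewrite (le_lt_trans (probability_le1 _ _)) // ltry.
exists 1; split; first exact: num_real.
move=> M M1 l _; have /andP[f0 f1] := f01 l.
by rewrite /= ger0_norm // (le_trans f1) // ltW.
Qed.

Lemma Rintegral_sum (I : Type) (r : seq I) (f : I -> L -> R) :
  (forall i, q.-integrable [set: L] (EFin \o f i)) ->
  Rintegral q [set: L] (fun l => \sum_(i <- r) f i l) =
  \sum_(i <- r) Rintegral q [set: L] (f i).
Proof.
move=> fi; elim: r => [|i r IH].
  rewrite big_nil; under eq_Rintegral do rewrite big_nil.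
  by rewrite Rintegral_cst // mul0r.
under eq_Rintegral do rewrite big_cons.
rewrite big_cons -IH RintegralD //.
have := integrable_sum (mu := q) (P := xpredT) measurableT r (fun i _ => fi i).
by under eq_fun do rewrite sumEFin.
Qed.

Lemma response_le1 (O : finType) (p : O -> L -> R) o l :
  response p -> 0 <= p o l <= 1.
Proof.
move=> [_ p0 p1]; rewrite p0 /= -(p1 l) (bigD1 o) //= lerDl.
by rewrite sumr_ge0.
Qed.

End BoundedIntegrals.

(* The left-hand side is affine in each variable, so it suffices to check the
   vertices of the cube, i.e. the independent sets of the pentagon. *)
Lemma kcbs_inequality (R : realFieldType) (y0 y1 y2 y3 y4 : R) :
  0 <= y0 <= 1 -> 0 <= y1 <= 1 -> 0 <= y2 <= 1 -> 0 <= y3 <= 1 ->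
  0 <= y4 <= 1 ->
  y0 * (1 - y1) + y1 * (1 - y2) + y2 * (1 - y3) + y3 * (1 - y4) + y4 * (1 - y0)
  <= 2.
Proof.
have affine (g : R -> R) : (forall t, g t = (1 - t) * g 0 + t * g 1) ->
    g 0 <= 2 -> g 1 <= 2 -> forall t, 0 <= t <= 1 -> g t <= 2.
  by move=> E g0 g1 t /andP[t0 t1]; rewrite E; nra.
move=> h0 h1 h2 h3 h4; move: y0 h0.
apply: (affine) => [t||]; first by ring.
all: move: y1 h1; apply: (affine) => [t||]; first by ring.
all: move: y2 h2; apply: (affine) => [t||]; first by ring.
all: move: y3 h3; apply: (affine) => [t||]; first by ring.
all: move: y4 h4; apply: (affine) => [t||]; first by ring.
all: lra.
Qed.

Section Contexts.
Variable R : realType.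
Local Notation C := R[i].
Variable theta : R.
Hypothesis cos_sqr : cos theta ^+ 2 = (Num.sqrt 5)^-1.

Lemma Z5_succ_neq (j : 'Z_5) : j != j + 1.
Proof. by case: j => -[|[|[|[|[|m]]]]] h. Qed.

Definition ctx_fst (X : party) (x y : meas X) : [fset x; y]%fset := [` fset21 x y]%fset.
Definition ctx_snd (X : party) (x y : meas X) : [fset x; y]%fset := [` fset22 x y]%fset.

Lemma joint_proj_fset2 d (X : party) (M : assignment R d X) (x y : meas X)
    (m : joint [fset x; y]%fset) : x != y ->
  (forall s t, comm_mx (M x s) (M y t)) ->
  joint_proj M m = M x (m (ctx_fst x y)) *m M y (m (ctx_snd x y)).
Proof.
move=> xy cM; rewrite /joint_proj.
case: (index_enum_fset2 xy) => E; rewrite E 2!big_cons big_nil mulmx1 //.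
exact/esym/cM.
Qed.

Lemma kcbs_proj_comm_mx (j : 'Z_5) (s t : bool) :
  comm_mx (@kcbs_proj R theta j s) (@kcbs_proj R theta (j + 1) t).
Proof. exact: (esym (kcbs_proj_comm cos_sqr j s t)). Qed.

Lemma joint_proj_kcbs (j : 'Z_5)
    (m : joint (X := kcbs_party) [fset j; (j + 1)%R]%fset) :
  joint_proj (kcbs_proj theta) m =
  @kcbs_proj R theta j (m (@ctx_fst kcbs_party j (j + 1))) *m
    @kcbs_proj R theta (j + 1) (m (@ctx_snd kcbs_party j (j + 1))).
Proof.
exact: (@joint_proj_fset2 3 kcbs_party (kcbs_proj theta) j (j + 1) m
  (Z5_succ_neq j) (kcbs_proj_comm_mx j)).
Qed.

(** [Some k] assigns -1 to the nonadjacent vertices [k] and [k + 2], and [None] to no vertex. Each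
    vertex lies in two of the five pairs, so pairs of weight [p / 2] give it the outcome -1 with
    probability [p]. *)
Definition hits (j : 'Z_5) (h : option 'Z_5) : bool :=
  if h is Some k then (j == k) || (j == k + 2) else false.

Lemma hits_shift (j k : 'Z_5) :
  hits j (Some (j + k)) = ((k == 0%N :> nat) || (k == 3%N :> nat)).
Proof.
rewrite /hits -addrA -{1 3}(addr0 j) !(inj_eq (addrI j)).
by case: k => -[|[|[|[|[|m]]]]] h.
Qed.

Lemma hits_shiftS (j k : 'Z_5) :
  hits (j + 1) (Some (j + k)) = ((k == 1%N :> nat) || (k == 4%N :> nat)).
Proof.
rewrite /hits -addrA !(inj_eq (addrI j)).
by case: k => -[|[|[|[|[|m]]]]] h.
Qed.

Definition hit_weight (p : C) (h : option 'Z_5) : C :=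
  if h is Some k then p / 2 else 1 - 5 * p / 2.

Lemma hit_weight_sum p : \sum_h hit_weight p h = 1.
Proof.
rewrite big_option /= sumr_const card_ord (_ : (Zp_trunc 5).+2 = 5%N) //.
by rewrite -(mulr_natr (_ / _)); field.
Qed.

Lemma hit_weight_context p j (s t : bool) :
  \sum_h hit_weight p h * ((hits j h == s)%:R * (hits (j + 1) h == t)%:R) =
  if s then (if t then 0 else p) else if t then p else 1 - 2 * p.
Proof.
rewrite big_option /= (reindex_inj (addrI j)) /=.
under eq_bigr => k _ do rewrite -/(hits j (Some (j + k))) hits_shift
  -/(hits (j + 1) (Some (j + k))) hits_shiftS.
rewrite !big_ord_recl big_ord0 /=.
by case: s; case: t; rewrite /= ?(mulr0, mulr1, addr0, add0r); field.
Qed.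

(** The condition [5 p <= 2] is nonnegativity of the weight of [None]. As the mean of [D] is
    [5 - 20 p], it is exactly the KCBS bound. *)
Lemma kcbs_noncontextual (a b : C) :
  a + 2 * b = 1 -> 0 <= kcbs_prob a b -> 5 * kcbs_prob a b <= 2 ->
  noncontextual (born_local (kcbs_proj theta) (loc_state a b)).
Proof.
move=> ab1 p0 p2; set p := kcbs_prob a b in p0 p2.
have w0 h : 0 <= hit_weight p h.
  case: h => [k|] /=; first by rewrite divr_ge0 ?ler0n.
  by rewrite subr_ge0 ler_pdivrMr ?ltr0n // mul1r.
have [q [g qE]] := finite_hidden_variable w0 (hit_weight_sum p).
exists _, nat, q, (fun j (s : bool) n => (hits j (g n) == s)%:R); split.
- move=> j; split.
  + by move=> o _ Y mY; exact: I.
  + by move=> o n; rewrite ler0n.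
  + by move=> n; rewrite big_bool; case: (hits _ _); rewrite /= ?addr0 ?add0r.
move=> K [j _ <-] m; rewrite /born_local joint_proj_kcbs tr_loc_context //.
rewrite -/p ab1.
pose s : bool := m (@ctx_fst kcbs_party j (j + 1)); pose t : bool := m (@ctx_snd kcbs_party j (j + 1)).
transitivity (\sum_h hit_weight p h *
    ((hits j h == s)%:R * (hits (j + 1) h == t)%:R : R)%:C).
  rewrite -[LHS](hit_weight_context p j s t); apply: eq_bigr => h _.
  by rewrite rmorphM !rmorph_nat.
rewrite qE; last by move=> h; rewrite mulr_ge0 ?ler0n.
congr (_%:C); apply: eq_Rintegral => n _.
by rewrite (prod_fset2 (Z5_succ_neq j)).
Qed.

(** The joint probability of Alice's outcome [|0><0|] and Bob's outcome -1 for [B_j], that is, 2/3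
    of the conditional one. *)
Definition steered_prob : R := 5 / 72 + 33 / 72 / Num.sqrt 5.

Lemma steered_probE : kcbs_prob (19 / 36) (5 / 72) = (steered_prob)%:C :> C.
Proof.
rewrite /kcbs_prob /steered_prob; move: (Num.sqrt 5)^-1 => t.
have -> : 19 / 36 = (19 / 36)%:C :> C by rewrite fmorph_div /= !rmorph_nat.
have -> : 5 / 72 = (5 / 72)%:C :> C by rewrite fmorph_div /= !rmorph_nat.
by rewrite -!rmorphM -rmorphD /=; congr (_%:C); field.
Qed.

Lemma tr_rho_AB_proj0 (B : 'M[C]_3) :
  \tr (rho_AB R *m (proj0 R *t B)) = \tr (loc_state (19 / 36) (5 / 72) *m B).
Proof.
rewrite tr_rho_AB tr_loc_state tr_delta tr_mul_delta mxE /= mulr1n.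
by rewrite [\tr B]big_ord3; field.
Qed.

Lemma born_zero_proj (mA : joint (X := single_party) [fset tt]%fset) :
  joint_proj (@zero_proj R) mA = @zero_proj R tt (mA [` fset11 tt]%fset).
Proof. by rewrite /joint_proj index_enum_fset1 big_cons big_nil mulmx1. Qed.

(** Alice's response to [|0><0|] acts as a density [a] on the hidden variable. Multiplying the
    pointwise KCBS inequality by [a] and integrating would give [5 * steered_prob <= 4 / 3]. The
    outcomes (-1, +1) suffice for this: two neighbours never both yield -1, so this pair has the
    full weight [steered_prob]. *)
Lemma not_GNCHV_kcbs :
  ~ GNCHV (born (S := kcbs_scenario) (@zero_proj R) (kcbs_proj theta) (rho_AB R)).
Proof.
move=> [disp [L [q [pA [pB [rA rB E]]]]]].
pose a := pA tt true.
pose y (j : 'Z_5) (s : bool) := pB j s.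
pose G j s t l := a l * (y j s l * y (j + 1) t l).
have G_int j s t : q.-integrable [set: L] (EFin \o G j s t).
  apply: unit_integrable.
    have [mA _ _] := rA tt; have [mj _ _] := rB j; have [mj' _ _] := rB (j + 1).
    apply: measurable_funM; first exact: mA.
    by apply: measurable_funM; [exact: mj | exact: mj'].
  move=> l; have /andP[a0 a1] := response_le1 true l (rA tt).
  have /andP[b0 b1] := response_le1 s l (rB j).
  have /andP[c0 c1] := response_le1 t l (rB (j + 1)).
  by rewrite !mulr_ge0 //= !mulr_ile1 // mulr_ge0.
have EG j s t : (Rintegral q [set: L] (G j s t))%:C =
    if s then (if t then 0 else (steered_prob)%:C)
    else if t then (steered_prob)%:C else 2 / 3 - 2 * (steered_prob)%:C.
  pose mA : joint (X := single_party) [fset tt]%fset := [ffun=> true].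
  pose K : {fset meas kcbs_party} := [fset j; (j + 1)%R]%fset.
  pose k0 : K := @ctx_fst kcbs_party j (j + 1).
  pose k1 : K := @ctx_snd kcbs_party j (j + 1).
  have k01 : (k1 == k0) = false.
    by rewrite -val_eqE eq_sym; apply/negbTE/Z5_succ_neq.
  pose mB : joint (X := kcbs_party) K := [ffun k : K => if k == k0 then s else t].
  have m0 : mB k0 = s by rewrite ffunE eqxx.
  have m1 : mB k1 = t by rewrite ffunE k01.
  have TT : tested kcbs_scenario ([fset tt]%fset, K) by split => //; exists j.
  have := E _ _ TT mA mB; rewrite /born born_zero_proj ffunE /= tr_rho_AB_proj0.
  rewrite joint_proj_kcbs -/k0 -/k1 m0 m1 tr_loc_context // steered_probE.
  move=> e; transitivity (if s then (if t then 0 else (steered_prob)%:C)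
    else if t then (steered_prob)%:C
    else 19 / 36 + 2 * (5 / 72) - 2 * (steered_prob)%:C); last first.
    by case: s {m0 G_int e mB m1} => //; case: t => //; congr (_ - _); field.
  rewrite e; congr (_%:C); apply: eq_Rintegral => l _.
  rewrite index_enum_fset1 big_seq1 ffunE.
  by rewrite (prod_fset2 (Z5_succ_neq j)) -/k0 -/k1 m0 m1.
have Gtf j : Rintegral q [set: L] (G j true false) = steered_prob.
  by apply: (@complexI R); rewrite EG.
have Ia : Rintegral q [set: L] a = 2 / 3.
  apply: (@complexI R).
  (* Alice's marginal is recovered by summing over Bob's four outcome pairs in one context. *)
  transitivity (\sum_(st : bool * bool) Rintegral q [set: L] (G 0 st.1 st.2))%:C.
    congr (_%:C); rewrite -Rintegral_sum; last by move=> i; exact: G_int.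
    apply: eq_Rintegral => l _.
    rewrite -(pair_bigA _ (fun s t => G 0 s t l)) /= /G.
    under eq_bigr do rewrite -mulr_sumr -mulr_sumr.
    have [_ _ p0] := rB 0; have [_ _ p1] := rB (0 + 1).
    by rewrite p1 -mulr_sumr; under eq_bigr do rewrite mulr1; rewrite p0 mulr1.
  rewrite rmorph_sum -(pair_bigA _ (fun s t => (Rintegral q [set: L] (G 0 s t))%:C)) /=.
  rewrite !big_bool /= !EG rmorphM fmorphV !rmorph_nat; ring.
have a_int : q.-integrable [set: L] (EFin \o a).
  apply: unit_integrable; first by have [mA _ _] := rA tt; exact: mA.
  by move=> l; exact: response_le1 (rA tt).
have : Rintegral q [set: L] (fun l => \sum_(j : 'Z_5) G j true false l) <=
    Rintegral q [set: L] (fun l => a l + a l).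
  apply: le_Rintegral => //.
  - have := integrable_sum (mu := q) (P := xpredT) measurableT
      (index_enum 'Z_5) (fun j _ => G_int j true false).
    by under eq_fun do rewrite sumEFin.
  - exact: (integrableD measurableT a_int a_int).
  move=> l _; have /andP[a0 _] := response_le1 true l (rA tt).
  rewrite /G -mulr_sumr -/(a l).
  have yf j : y j false l = 1 - y j true l.
    have [_ _ /(_ l)] := rB j; rewrite big_bool /= /y.
    by move: (pB j true l) (pB j false l) => u v <-; rewrite addrAC subrr add0r.
  under eq_bigr do rewrite yf.
  have y01 j : 0 <= y j true l <= 1 by exact: response_le1 (rB j).
  rewrite big_Z5.
  have -> : (0 + 1 : 'Z_5) = 1 by apply: val_inj.
  have -> : (1 + 1 : 'Z_5) = 2 by apply: val_inj.
  have -> : (2 + 1 : 'Z_5) = 3 by apply: val_inj.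
  have -> : (3 + 1 : 'Z_5) = 4 by apply: val_inj.
  have -> : (4 + 1 : 'Z_5) = 0 by apply: val_inj.
  have := kcbs_inequality (y01 0) (y01 1) (y01 2) (y01 3) (y01 4).
  move=> le2; have -> : a l + a l = a l * 2 by ring.
  exact: (ler_wpM2l a0 le2).
rewrite Rintegral_sum // RintegralD // Ia.
under eq_bigr do rewrite Gtf.
rewrite sumr_const card_ord (_ : (Zp_trunc 5).+2 = 5%N) // leNgt => /negP; apply.
rewrite -(mulr_natr steered_prob) /steered_prob.
have s0 := sqrt5_gt0 R; have s2 := sqrt5_sqr R.
have e : (Num.sqrt 5)^-1 = Num.sqrt 5 / 5 :> R.
  by apply: (mulfI (lt0r_neq0 s0)); rewrite mulfV ?lt0r_neq0 // mulrA -expr2 s2 divff // pnatr_eq0.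
(* [4 / 3 < 5 * steered_prob] amounts to [71 / 33 < sqrt 5]. *)
rewrite e; have : 71 / 33 < Num.sqrt 5 :> R.
  by rewrite -(@ltr_pXn2r _ 2) ?nnegrE ?divr_ge0 ?ltW // s2; lra.
lra.
Qed.

End Contexts.

(** * Numerical values of the KCBS quantities *)

Section KCBSValues.
Variable R : realType.
Local Notation C := R[i].
Local Notation r5 := (Num.sqrt 5 : R).

Lemma invr_sqrt5 : r5^-1 = r5 / 5.
Proof.
have s0 := sqrt5_gt0 R; apply: (mulfI (lt0r_neq0 s0)).
by rewrite mulfV ?lt0r_neq0 // mulrA -expr2 sqrt5_sqr divff // pnatr_eq0.
Qed.

Lemma kcbs_prob_real (x y : R) :
  kcbs_prob x%:C y%:C = (x / r5 + y * (1 - r5^-1))%:C.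
Proof. by rewrite /kcbs_prob -!rmorphM -rmorphD. Qed.

Lemma ratC (m n : nat) : (m%:R / n%:R : C) = (m%:R / n%:R : R)%:C.
Proof. by rewrite fmorph_div !rmorph_nat. Qed.

Lemma kcbs_prob_marginal : kcbs_prob (2 / 3) 6^-1 = (1 / 6 + r5 / 10)%:C :> C.
Proof.
rewrite -[X in kcbs_prob _ X]mul1r !(ratC 1) !(ratC 2) kcbs_prob_real invr_sqrt5.
by congr (_%:C); move: r5 => s; field.
Qed.

Lemma kcbs_prob_conditional :
  kcbs_prob (19 / 24) (5 / 48) = (5 / 48 + 11 / 80 * r5)%:C :> C.
Proof.
rewrite (ratC 19) (ratC 5) kcbs_prob_real invr_sqrt5.
by congr (_%:C); move: r5 => s; field.
Qed.

Lemma sqrt5_lbound : 11 / 5 < r5.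
Proof.
have s0 := sqrt5_gt0 R.
by rewrite -(@ltr_pXn2r _ 2) ?nnegrE ?divr_ge0 ?ltW // sqrt5_sqr; lra.
Qed.

(** 7/3 is the exact threshold both for [-3 < 5 / 3 - 2 sqrt 5] and for [5 p <= 2] at the marginal
    state. *)
Lemma sqrt5_ubound : r5 < 7 / 3.
Proof.
have s0 := sqrt5_gt0 R.
by rewrite -(@ltr_pXn2r _ 2) ?nnegrE ?divr_ge0 ?ltW // sqrt5_sqr; lra.
Qed.

Lemma kcbs_value_marginal :
  5 * (2 / 3 + 2 * 6^-1) - 20 * kcbs_prob (2 / 3) 6^-1 = (5 / 3 - 2 * r5)%:C :> C.
Proof.
rewrite kcbs_prob_marginal.
have -> : 5 * (2 / 3 + 2 * 6^-1) = 5 :> C by field.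
rewrite -(rmorph_nat (real_complex R) 5) -(rmorph_nat (real_complex R) 20).
by rewrite -rmorphM -rmorphB; congr (_%:C); field.
Qed.

Lemma kcbs_value_conditional :
  5 * (19 / 24 + 2 * (5 / 48)) - 20 * kcbs_prob (19 / 24) (5 / 48)
  = ((35 - 33 * r5) / 12)%:C :> C.
Proof.
rewrite kcbs_prob_conditional.
have -> : 5 * (19 / 24 + 2 * (5 / 48)) = 5 :> C by field.
rewrite -(rmorph_nat (real_complex R) 5) -(rmorph_nat (real_complex R) 20).
by rewrite -rmorphM -rmorphB; congr (_%:C); field.
Qed.

Lemma kcbs_prob_marginal_bounds :
  0 <= kcbs_prob (2 / 3) 6^-1 :> C /\ 5 * kcbs_prob (2 / 3) 6^-1 <= 2 :> C.
Proof.
have lo := sqrt5_lbound; have hi := sqrt5_ubound.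
rewrite kcbs_prob_marginal; split; first by rewrite lecR; lra.
rewrite -(rmorph_nat (real_complex R) 5) -(rmorph_nat (real_complex R) 2).
by rewrite -rmorphM lecR; lra.
Qed.

End KCBSValues.

Theorem mainTheorem4 (R : realType) (theta : R)
    (cos_gt0 : 0 < cos theta) (sin_gt0 : 0 < sin theta)
    (cos_sqr : cos theta ^+ 2 = (Num.sqrt 5)^-1) :
  let rho := rho_AB R in
  let P0 := proj0 R in
  let D := kcbs_op theta in
  let rho_B0 := condB rho P0 in
  [/\ (* (i) *)
      [/\ entangled rho,
          eigenvalue (ptranspose rho)
            ((37 - 3 * Num.sqrt 177 : R) / 144)%:C &
          (37 - 3 * Num.sqrt 177 : R) / 144 < 0],
      (* (ii) *)
      local_projective rho /\
      (forall (S : scenario)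
              (M : assignment R 3 (alice S)) (N : assignment R 3 (bob S)),
         compatible_projective M -> compatible_projective N ->
         GLHV (born M N rho)),
      (* (iii) *)
      let rho_loc : 'M[R[i]]_3 :=
        (2 / 3) *: delta_mx 0 0 + 6^-1 *: delta_mx 1 1
        + 6^-1 *: delta_mx 2 2 in
      [/\ redA rho = rho_loc /\ redB rho = rho_loc,
          \tr (redB rho *m D) = (5 / 3 - 2 * Num.sqrt 5 : R)%:C,
          (5 / 3 - 2 * Num.sqrt 5 : R) > -3 &
          noncontextual (born_local (kcbs_proj theta) (redB rho))],
      (* (iv) *)
      [/\ probA rho P0 = 2 / 3,
          rho_B0 = (19 / 24) *: delta_mx 0 0 + (5 / 48) *: delta_mx 1 1
                   + (5 / 48) *: delta_mx 2 2,
          \tr (rho_B0 *m D) = ((35 - 33 * Num.sqrt 5 : R) / 12)%:C &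
          (35 - 33 * Num.sqrt 5 : R) / 12 < -3] &
      (* (v) *)
      ~ GNCHV (born (S := kcbs_scenario) (@zero_proj R) (kcbs_proj theta)
                    rho)].
Proof.
move=> rho P0 D rho_B0.
have lo := sqrt5_lbound R; have hi := sqrt5_ubound R.
have [zeta zeta_prim] := prim7_root_exists R[i].
have loc : local_projective rho := local_projective_rho_AB zeta_prim.
split.
- split; [exact: rho_AB_entangled | exact: ptranspose_eigenvalue |].
  exact: ptval_lt0.
- split; first exact: loc.
  by move=> S M N; apply: local_projective_GLHV.
- move=> rho_loc; split.
  + by split; [exact: redA_rho_AB | exact: redB_rho_AB].
  + by rewrite redB_rho_AB (tr_loc_kcbs_op cos_sqr) kcbs_value_marginal.
  + lra.
  + rewrite redB_rho_AB; have [p0 p2] := kcbs_prob_marginal_bounds R.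
    by apply: kcbs_noncontextual => //; field.
- split; [exact: probA_rho_AB | exact: condB_rho_AB | |lra].
  by rewrite /rho_B0 condB_rho_AB (tr_loc_kcbs_op cos_sqr) kcbs_value_conditional.
- exact: not_GNCHV_kcbs.
Qed.
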